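(* Let $E$ be a real locally convex Hausdorff topological vector space. Then $E$ has the metric convex compactness property if and only if the following condition holds: whenever $X$ is a topological space, $\nu$ is a metrically regular (positive) Borel measure on $X$, $D\subset E$ is a bounded closed absolutely convex set with associated gauge functional $\varphi_D:E\to[0,\infty]$, and $g:X\to E$ is a $\nu$-Lusin-measurable function with $\int_X \varphi_D\circ g\,d\nu<\infty$, the function $g$ is $\nu$-Pettis-integrable.
   Context: A locally convex Hausdorff space $E$ has the metric convex compactness property if for every compact metrizable subset $K\subset E$ (metrizable in the relative topology) the closed convex hull of $K$ in $E$ is compact. A positive Borel measure $\mu$ on a topological space $X$ (not assumed finite) is called metrically regular if for every Borel set $B\subset X$, $$\mu(B)=\sup\{\mu(K): K\subset B,\ K \text{ compact and metrizable}\}.$$ A function $g$ on $X$ with values in a topological space is called $\mu$-Lusin-measurable if for every Borel set $B\subset X$, $$\mu(B)=\sup\{\mu(K): K\subset B \text{ compact},\ g|_K \text{ continuous}\}.$$ In both suprema $K$ ranges over Borel sets, so that $\mu(K)$ is defined (this is automatic if $X$ is Hausdorff). For a (nonempty) absolutely convex set $D\subset E$, the gauge functional is $\varphi_D(e)=\inf\{t>0: e\in tD\}$, with $\inf\emptyset=+\infty$; thus $\varphi_D(e)=+\infty$ if $e$ is not in the linear span of $D$. Let $E'$ denote the space of continuous linear functionals on $E$, with pairing $\langle e',e\rangle$. A function $g:X\to E$ is $\nu$-Pettis-integrable if for every $e'\in E'$ the scalar function $x\mapsto\langle e',g(x)\rangle$ is $\nu$-integrable and there is an element $r\in E$ such that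 $\langle e',r\rangle=\int_X\langle e',g(x)\rangle\,d\nu(x)$ for all $e'\in E'$; only the integral over the whole space $X$ is required to exist in $E$. Measurability and integrability of scalar functions on $X$ (including $\varphi_D\circ g$) are understood with respect to the completion of $\nu$. *)

(* Defs.v *)
From HB Require Import structures.
From mathcomp Require Import all_boot all_order all_algebra.
From mathcomp Require Import all_classical all_reals all_analysis.
From mathcomp Require Import measurable_realfun.

Set Implicit Arguments.
Unset Strict Implicit.
Unset Printing Implicit Defensive.

Import Order.TTheory GRing.Theory Num.Theory.
Import numFieldNormedType.Exports.

Local Open Scope classical_set_scope.
Local Open Scope ring_scope.

(* Completion of an arbitrary (not necessarily sigma-finite) measure: its
   measurable sets are the A `|` N with A measurable and N negligible.  The
   Caratheodory sigma-algebra of [mu^*] would be too large when mu is not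
   sigma-finite, since it also contains the locally measurable sets. *)
Section completion.
Context d (T : measurableType d) (R : realType).
Variable mu : {measure set T -> \bar R}.

Definition completion_type : Type :=
  g_sigma_algebraType (completed_algebra_gen mu).

HB.instance Definition _ := Measurable.on completion_type.

Lemma sigma_algebra_completed : sigma_algebra setT (completed_algebra_gen mu).
Proof.
split => /=.
- by exists set0 => //; exists set0; [exact: negligible_set0|rewrite setU0].
- move=> _ [A mA [N [F [mF F0 NF]] <-]].
  exists (~` A `\` F).
    by apply: measurableD => //; exact: measurableC.
  exists ((~` A `\` N) `&` F).
    by exists F; split => // x [].
  rewrite setTD; apply/seteqP; split => x /=.
    by case=> [[nA nF] [//|/NF]|[[nA nN] _] []].
  move=> nAN; have [Fx|nF] := pselect (F x); [right|left].
    by split=> //; split => ?; apply: nAN; [left|right].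
  by split=> // ?; apply: nAN; left.
- move=> F mF.
  pose A n := projT1 (cid2 (mF n)).
  pose N n := projT1 (cid2 (projT2 (cid2 (mF n))).2).
  exists (\bigcup_k A k).
    by apply: bigcupT_measurable => i; rewrite /A; case: cid2.
  exists (\bigcup_k N k).
    apply: negligible_bigcup => /= k.
    by rewrite /N; case: (cid2 (mF k)) => //= *; case: cid2.
  rewrite -bigcupU; apply: eq_bigcup => // i _.
  by rewrite /A /N; case: (cid2 (mF i)) => //= *; case: cid2.
Qed.

Lemma completion_measurableE :
  measurable = completed_algebra_gen mu :> set (set completion_type).
Proof. exact: (measurable_g_measurableTypeE sigma_algebra_completed). Qed.

Definition completion : set completion_type -> \bar R := (mu^*)%mu.

Lemma completionE (A N : set T) : measurable A -> mu.-negligible N ->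
  completion (A `|` N) = mu A.
Proof.
move=> mA [F [mF F0 NF]]; rewrite /completion -(measurable_mu_extE mu mA).
apply/eqP; rewrite eq_le; apply/andP; split; last first.
  by apply: le_mu_ext; exact: subsetUl.
apply: (@le_trans _ _ ((mu^*)%mu (A `|` F))); first by apply: le_mu_ext; exact: setUS.
rewrite !measurable_mu_extE//; last exact: measurableU.
rewrite -[leRHS]adde0 -F0; exact: measureU2.
Qed.

Lemma completion_sub_caratheodory :
  (measurable : set (set completion_type)) `<=` ((mu^*)%mu).-cara.-measurable.
Proof.
rewrite completion_measurableE => _ [A mA [N [F [mF F0 NF]] <-]].
apply: measurableU.
  by apply: sub_caratheodory; exact: sub_sigma_algebra.
apply: le_caratheodory_measurable => /= X.
have N0 : ((mu^*)%mu (X `&` N) = 0)%E.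
  apply/eqP; rewrite eq_le outer_measure_ge0 andbT -F0 -(measurable_mu_extE mu mF).
  by apply: le_mu_ext => x [_ /NF].
by rewrite N0 add0e; apply: le_mu_ext; exact: subIsetl.
Qed.

Let completion0 : (completion set0 = 0)%E.
Proof. exact: mu_ext0. Qed.

Let completion_ge0 A : (0 <= completion A)%E.
Proof. exact: mu_ext_ge0. Qed.

Let completion_semi_sigma_additive : semi_sigma_additive completion.
Proof.
move=> F mF tF mUF; apply: caratheodory_measure_sigma_additive => //.
- by move=> i; exact: completion_sub_caratheodory.
- exact: completion_sub_caratheodory.
Qed.

HB.instance Definition _ := isMeasure.Build _ _ _ completion
  completion0 completion_ge0 completion_semi_sigma_additive.

End completion.

Arguments completion {d T R} mu _.

(* Only the values of d on K matter; the last clause says that d induces the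
   relative topology of K. *)
Definition metrizable (R : realType) (T : topologicalType) (K : set T) : Prop :=
  exists d : T -> T -> R,
    [/\ forall x y, K x -> K y -> 0 <= d x y,
        forall x y, K x -> K y -> (d x y = 0 <-> x = y),
        forall x y, K x -> K y -> d x y = d y x,
        forall x y z, K x -> K y -> K z -> d x z <= d x y + d y z &
        forall x, K x -> forall A : set T, within K (nbhs x) A <->
          exists2 e : R, 0 < e & forall y, K y -> d x y < e -> A y].

Section locally_convex_spaces.
Context (R : realType) (E : tvsType R).

Definition closed_convex_hull (K : set E) : set E :=
  smallest [set C : set E | closed C /\ convex_set C] K.

Definition metric_convex_compactness : Prop :=
  forall K : set E, compact K -> metrizable R K -> compact (closed_convex_hull K).

(* [bounded_set] is only available for normed spaces. *)
Definition tvs_bounded (D : set E) : Prop :=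
  forall U : set E, nbhs 0 U ->
    exists2 r : R, 0 < r & forall s : R, r <= `|s| -> D `<=` *:%R s @` U.

Definition absolutely_convex (D : set E) : Prop :=
  [/\ D !=set0, convex_set D &
      forall (a : R) (x : E), `|a| <= 1 -> D x -> D (a *: x)].

(* The infimum of the empty set is +oo in \bar R. *)
Definition gauge_functional (D : set E) (e : E) : \bar R :=
  ereal_inf [set t%:E | t in [set t : R | 0 < t /\ ( *:%R t @` D) e]].

Definition pettis_integrable d (T : measurableType d)
    (mu : {measure set T -> \bar R}) (g : T -> E) : Prop :=
  (forall e' : {linear E -> R^o}, continuous e' ->
    (completion mu).-integrable setT (fun x => (e' (g x))%:E)) /\
  exists r : E, forall e' : {linear E -> R^o}, continuous e' ->
    (e' r)%:E = (\int[completion mu]_x (e' (g x))%:E)%E.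

End locally_convex_spaces.

(* A [measurableType] is pointed by construction, hence X has to be nonempty;
   every function on the empty space is trivially Pettis-integrable. *)
Definition borel_type (X : ptopologicalType) : Type :=
  g_sigma_algebraType (@open X).

HB.instance Definition _ (X : ptopologicalType) := Measurable.on (borel_type X).

Section borel_measures.
Context (R : realType) (X : ptopologicalType).
Variable nu : {measure set (borel_type X) -> \bar R}.

Definition metrically_regular : Prop :=
  forall B : set (borel_type X), measurable B ->
    nu B = ereal_sup [set nu K | K in [set K : set (borel_type X) |
      [/\ measurable K, K `<=` B, compact (K : set X) &
          metrizable R (K : set X)]]].

Definition lusin_measurable (Y : topologicalType) (g : X -> Y) : Prop :=
  forall B : set (borel_type X), measurable B ->
    nu B = ereal_sup [set nu K | K in [set K : set (borel_type X) |
      [/\ measurable K, K `<=` B, compact (K : set X) &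
          {within (K : set X), continuous g}]]].

End borel_measures.

(* Main.v *)
Require Import Defs.
From HB Require Import structures.
From mathcomp Require Import all_boot all_order all_algebra.
From mathcomp Require Import all_classical all_reals all_analysis.
From mathcomp Require Import measurable_realfun.
From mathcomp Require Import ring lra.

(* Metric convex compactness implies the integrability condition: up to a null
   set outside which [g] vanishes, [X] is covered by compact metrizable sets
   [K j] on which [g] is continuous and the gauge of [g] is of the order of a
   constant [beta j]; after disjointization the series of the [beta j * nu (K j)]
   converges. Hence it still converges after division by suitable [eps j] tending
   to [0], and the images of the [K j] under [eps j / beta j *: g], together with
   [0], form a compact metrizable set: they tend to [0] because [D] is bounded.
   A multiple of its compact closed convex hull contains the integral of [g].

   Conversely, let [h] be a continuous map of the Cantor space onto a compact
   metrizable [K]. A probability measure on the Cantor space is the image of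
   Lebesgue measure on [0, 1[ under a map which is continuous off a countable
   set, so the condition applied to its composition with [h] shows that every
   such measure has a barycenter in [E]. The probability measures on the Cantor
   space form a compact set, encoded by their masses on cylinders, on which the
   barycenter is a uniform limit of finite sums of continuous maps. The set of
   barycenters is thus a compact convex set containing [K]. *)

Set Implicit Arguments.
Unset Strict Implicit.
Unset Printing Implicit Defensive.

Import Order.TTheory GRing.Theory Num.Theory.
Import numFieldNormedType.Exports.

Local Open Scope classical_set_scope.
Local Open Scope ring_scope.

(** * Separation of convex sets *)

Section sublinear_functionals.
Context (R : realType) (E : lmodType R).
Implicit Types (p q f : E -> R) (x y z : E).

Definition sublinear p :=
  (forall x y, p (x + y) <= p x + p y) /\
  (forall (t : R) x, 0 <= t -> p (t *: x) = t * p x).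

Lemma sublinear0 p : sublinear p -> p 0 = 0.
Proof. by case=> _ /(_ 0 0 (lexx 0)); rewrite scale0r mul0r. Qed.

Lemma sublinear_opp p x : sublinear p -> - p (- x) <= p x.
Proof.
by move=> pP; have := pP.1 x (- x); rewrite subrr sublinear0//; lra.
Qed.

(** The dominating [h] may depend on the arguments, so the conditions cover both chains and the
    shifted family below. One inequality suffices for homogeneity: applied to the inverse scalar it
    yields the other one. *)
Lemma sublinear_inf (F : set (E -> R)) : F !=set0 ->
  (forall x, has_lbound [set f x | f in F]) ->
  (forall f g x y, F f -> F g -> exists2 h, F h & h (x + y) <= f x + g y) ->
  (forall t f x, 0 < t -> F f -> exists2 h, F h & h (t *: x) <= t * f x) ->
  sublinear (fun x => inf [set f x | f in F]).
Proof.
move=> [f0 Ff0] lF FD FZ; pose q x := inf [set f x | f in F].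
have qle f x : F f -> q x <= f x by move=> Ff; apply: ge_inf => //; exists f.
have leq x c : (forall f, F f -> c <= f x) -> c <= q x.
  move=> cF; apply: lb_le_inf; first by exists (f0 x), f0.
  by move=> _ [f Ff <-]; exact: cF.
have qZ t x : 0 < t -> q (t *: x) <= t * q x.
  move=> t0; rewrite -ler_pdivrMl//; apply: (leq _ _) => f Ff.
  rewrite ler_pdivrMl//; have [h Fh hf] := FZ _ _ x t0 Ff.
  exact: le_trans (qle _ _ Fh) hf.
have qZE t x : 0 < t -> q (t *: x) = t * q x.
  move=> t0; apply/eqP; rewrite eq_le qZ//= -ler_pdivlMl//.
  by rewrite (le_trans _ (qZ _ _ _)) ?invr_gt0// scalerA mulVf ?gt_eqF// scale1r.
have q0 : q 0 = 0.
  by have := qZE 2 0 ltac:(lra); rewrite scaler0; lra.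
split=> [x y|t x].
  suff : q (x + y) - q y <= q x by rewrite lerBlDr.
  apply: (leq _ _) => f Ff; suff : q (x + y) - f x <= q y by rewrite lerBlDr lerBlDl.
  apply: (leq _ _) => g Fg; rewrite lerBlDl.
  have [h Fh hfg] := FD _ _ x y Ff Fg.
  exact: le_trans (qle _ _ Fh) hfg.
by rewrite le0r => /predU1P[->|]; [rewrite scale0r mul0r|exact: qZE].
Qed.

(* The infimum over [t >= 0] of [x |-> q (x + t y) - t q y]: below [q], and
   linear along the line of [y]. *)
Lemma sublinear_shift q y : sublinear q ->
  exists q', [/\ sublinear q', forall x, q' x <= q x & q' (- y) <= - q y].
Proof.
move=> qP; pose F : set (E -> R) :=
  [set (fun x => q (x + t *: y) - t * q y) | t in [set t : R | 0 <= t]].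
have lF x : has_lbound [set f x | f in F].
  exists (- q (- x)) => _ [_ [t /= t0 <-] <-].
  have := qP.1 (x + t *: y) (- x); rewrite addrAC subrr add0r qP.2//; lra.
exists (fun x => inf [set f x | f in F]); split.
- apply: sublinear_inf => //; first by exists (fun x => q (x + 0 *: y) - 0 * q y), 0 => /=.
    move=> _ _ x z [s /= s0 <-] [t /= t0 <-].
    exists (fun x => q (x + (s + t) *: y) - (s + t) * q y).
      by exists (s + t) => //=; exact: addr_ge0.
    rewrite scalerDl [x + z + _]addrACA mulrDl.
    have := qP.1 (x + s *: y) (z + t *: y); lra.
  move=> t _ x t0 [s /= s0 <-].
  exists (fun x => q (x + (t * s) *: y) - (t * s) * q y).
    by exists (t * s) => //=; rewrite mulr_ge0// ltW.
  by rewrite -scalerA -scalerDr (qP.2 _ _ (ltW t0)) mulrBr mulrA.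
- move=> x; apply: ge_inf => //.
  by exists (fun x => q (x + 0 *: y) - 0 * q y); [exists 0 => /=|
    rewrite scale0r addr0 mul0r subr0].
- apply: ge_inf => //; exists (fun x => q (x + 1 *: y) - 1 * q y).
    by exists 1 => //=.
  by rewrite scale1r addNr sublinear0// mul1r sub0r.
Qed.

(** Zorn's lemma for the reversed pointwise order. The bound [- p (- x)] keeps the infimum of a
    chain finite, and [p] itself bounds the empty chain. *)
Lemma minimal_sublinear p : sublinear p ->
  exists q, [/\ sublinear q, forall x, q x <= p x &
    forall q', sublinear q' -> (forall x, q' x <= q x) -> q' = q].
Proof.
move=> pP; pose P (q : E -> R) := sublinear q /\ forall x, q x <= p x.
pose T := {q : E -> R | P q}.
pose r (a b : T) := `[< forall x, sval b x <= sval a x >].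
have [|||A Atot|m mP] := @Zorn T r.
- by move=> t; apply/asboolP.
- by move=> a b c /asboolP ab /asboolP bc; apply/asboolP => x; exact: le_trans (bc x) (ab x).
- move=> [a aP] [b bP] /asboolP ab /asboolP ba; apply: eq_exist; apply/funext => x.
  by apply/eqP; rewrite eq_le; apply/andP; split; [exact: ba|exact: ab].
- have [[a0 Aa0]|/nonemptyPn A0] := pselect (A !=set0); last first.
    by exists (exist P p (conj pP (fun x => lexx _))) => s; rewrite A0.
  pose F : set (E -> R) := [set sval a | a in A].
  have lF x : has_lbound [set f x | f in F].
    exists (- p (- x)) => _ [_ [a Aa <-] <-].
    rewrite (le_trans _ (sublinear_opp _ (svalP a).1))// lerN2.
    exact: (svalP a).2.
  have Fle a x : A a -> inf [set f x | f in F] <= sval a x.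
    by move=> Aa; apply: ge_inf => //; exists (sval a) => //; exists a.
  have FP : sublinear (fun x => inf [set f x | f in F]) /\
      forall x, inf [set f x | f in F] <= p x.
    split; last by move=> x; rewrite (le_trans (Fle _ _ Aa0))//; exact: (svalP a0).2.
    apply: sublinear_inf => //; first by exists (sval a0), a0.
      move=> _ _ x y [a Aa <-] [b Ab <-].
      have [/asboolP ab|/asboolP ba] := Atot _ _ Aa Ab.
        exists (sval b); first by exists b.
        by rewrite (le_trans ((svalP b).1.1 x y))// lerD2r.
      exists (sval a); first by exists a.
      by rewrite (le_trans ((svalP a).1.1 x y))// lerD2l.
    move=> t _ x t0 [a Aa <-]; exists (sval a); first by exists a.
    by rewrite ((svalP a).1.2 _ _ (ltW t0)).
  by exists (exist P (fun x => inf [set f x | f in F]) FP) => a Aa;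
      apply/asboolP => x /=; exact: Fle.
- exists (sval m); split; [exact: (svalP m).1|exact: (svalP m).2|].
  move=> q' q'P q'm.
  have q'p x : q' x <= p x by rewrite (le_trans (q'm x))//; exact: (svalP m).2.
  by have <- := mP (exist P q' (conj q'P q'p)); last exact/asboolP.
Qed.

(** A minimal sublinear functional is linear: its shift along any [y] lies below it, hence equals
    it, which gives [q (- y) <= - q y]. Shifting [p] along [z] before minimizing forces the value at
    [z]. *)
Lemma hahn_banach p z : sublinear p ->
  exists f : {linear E -> R^o}, (forall x, f x <= p x) /\ p z <= f z.
Proof.
move=> pP; have [p' [p'P p'p p'z]] := sublinear_shift z pP.
have [q [qP qp' qmin]] := minimal_sublinear p'P.
have qN y : q (- y) = - q y.
  have [q' [q'P q'q q'y]] := sublinear_shift y qP.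
  apply/eqP; rewrite eq_le; apply/andP; split.
    by rewrite -(qmin q' q'P q'q) (le_trans q'y)// lerN2.
  by rewrite lerNl sublinear_opp.
have qD x y : q (x + y) = q x + q y.
  apply/eqP; rewrite eq_le qP.1/=.
  by have := qP.1 (- x) (- y); rewrite -opprD !qN -opprD lerN2.
have qZ (t : R) x : q (t *: x) = t * q x.
  have [t0|/ltW t0] := leP 0 t; first exact: qP.2.
  by have := qP.2 (- t) x; rewrite oppr_ge0 scaleNr qN mulNr => /(_ t0)/oppr_inj.
have qL : linear (q : E -> R^o) by move=> a x y; rewrite qD qZ.
pose f : {linear E -> R^o} := HB.pack (q : E -> R^o) (GRing.isLinear.Build _ _ _ _ _ qL).
exists f; split=> [x|] /=; first by rewrite (le_trans (qp' x)).
have := qp' (- z); rewrite qN; lra.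
Qed.

End sublinear_functionals.

(** * Neighbourhoods of zero and continuous functionals *)

Section locally_convex.
Context (R : realType) (E : tvsType R).
Implicit Types (A U V : set E) (x y z : E).

Lemma functionalD (f : {linear E -> R^o}) x y : f (x + y) = f x + f y :> R.
Proof. exact: linearD. Qed.

Lemma functionalZ (f : {linear E -> R^o}) (a : R) x : f (a *: x) = a * f x :> R.
Proof. exact: linearZ. Qed.

Lemma functionalN (f : {linear E -> R^o}) x : f (- x) = - f x :> R.
Proof. exact: linearN. Qed.

Lemma functionalB (f : {linear E -> R^o}) x y : f (x - y) = f x - f y :> R.
Proof. exact: linearB. Qed.

Lemma convex_setP A : convex_set A <->
  forall x y (t : R), 0 <= t -> t <= 1 -> A x -> A y -> A (t *: x + (1 - t) *: y).
Proof.
split=> [cA x y t t0 t1 /mem_set Ax /mem_set Ay|cA x y l /set_mem Ax /set_mem Ay].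
  exact/set_mem/(cA x y (Itv01 t0 t1)).
by apply/mem_set/(cA x y l%:num).
Qed.

Lemma nbhs0_convex U : nbhs 0 U ->
  exists V, [/\ nbhs 0 V, convex_set V & V `<=` U].
Proof.
move=> U0; have [B cB [oB bB]] := @locally_convex R E.
have [V [BV V0] VU] := bB 0 U U0.
exists V; split=> //; last exact/cB/mem_set.
by apply: open_nbhs_nbhs; split=> //; exact: oB.
Qed.

Lemma nbhs_translate x A : nbhs 0 A -> nbhs x [set y | A (y - x)].
Proof.
move=> /(nbhsT x); apply: filterS => _ [v Av <-].
by rewrite /= addrAC subrr add0r.
Qed.

Lemma nbhs_origin x A : nbhs x A -> nbhs 0 [set v | A (x + v)].
Proof.
move=> xA; have := nbhsB (- x) xA; rewrite addNr; apply: filterS => _ [v Av <-].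
by rewrite /= addrA subrr add0r.
Qed.

Lemma nbhs0_scale (r : R) A : r != 0 -> nbhs 0 A -> nbhs 0 [set v | A (r *: v)].
Proof.
move=> r0 /(nbhs0Z (r := r^-1)); rewrite invr_eq0 => /(_ r0).
by apply: filterS => _ [v Av <-] /=; rewrite scalerA divff// scale1r.
Qed.

Lemma nbhs_scale (r : R) x A : nbhs (r *: x) A -> nbhs x [set v | A (r *: v)].
Proof.
move=> rA; have [[B1 B2] /= [/nbhs_singleton B1r B2x] BA] := @scale_continuous R E (r, x) A rA.
by apply: filterS B2x => v B2v; exact: (BA (r, v)).
Qed.

Lemma nbhs0_absorb V x : nbhs 0 V ->
  exists2 e : R, 0 < e & forall t, `|t| < e -> V (t *: x).
Proof.
move=> V0; have /= := @scale_continuous R E (0, x) V.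
rewrite scale0r => /(_ V0)[[B1 B2] /= [/nbhs_ballP[e e0 eB] B2x] BV].
exists e => // t te; apply: (BV (t, x)); split => /=; last exact: nbhs_singleton.
by apply: eB; rewrite /ball /= sub0r normrN.
Qed.

Lemma nbhs0_half V : nbhs 0 V ->
  exists2 W, nbhs 0 W & forall x y, W x -> W y -> V (x + y).
Proof.
move=> V0; have /= := @add_continuous E (0, 0) V; rewrite addr0 => /(_ V0).
move=> [[W1 W2] /= [W10 W20] WV]; exists (W1 `&` W2); first exact: filterI.
by move=> x y [W1x _] [_ W2y]; exact: (WV (x, y)).
Qed.

Lemma hausdorff_nbhs0 x : hausdorff_space E ->
  (forall U, nbhs 0 U -> U x) -> x = 0.
Proof.
move=> hE Ux; apply: hE => A B /nbhs_singleton Ax B0.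
by exists x; split=> //; exact: Ux.
Qed.

(** The Minkowski functional of [V]. As [V] is neither open nor closed in general, both comparisons
    with 1 are weak; as it need not be symmetric, [p] is sublinear but not a seminorm. *)
Lemma minkowski_sublinear V : nbhs 0 V -> convex_set V ->
  exists p : E -> R, [/\ sublinear p, forall x, V x -> p x <= 1 &
    forall x, ~ V x -> 1 <= p x].
Proof.
move=> V0 /convex_setP cV; have V00 : V 0 by exact: nbhs_singleton.
pose S x := [set t : R | 0 < t /\ V (t^-1 *: x)].
pose p x := inf (S x).
have S0 x : S x !=set0.
  have [e e0 eV] := nbhs0_absorb x V0; exists (2 * e^-1); split.
    by rewrite mulr_gt0// invr_gt0.
  apply: eV; rewrite gtr0_norm ?invr_gt0 ?mulr_gt0 ?invr_gt0//.
  by rewrite invf_div ltr_pdivrMr//; lra.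
have lS x : has_lbound (S x) by exists 0 => t [/ltW].
have ple x t : 0 < t -> V (t^-1 *: x) -> p x <= t.
  by move=> t0 Vt; apply: ge_inf.
have lep x c : (forall t, 0 < t -> V (t^-1 *: x) -> c <= t) -> c <= p x.
  by move=> h; apply: lb_le_inf => // t [t0 Vt]; exact: h.
have pZ t x : 0 < t -> p (t *: x) <= t * p x.
  move=> t0; rewrite -ler_pdivrMl//; apply: (lep _ _) => s s0 Vs.
  rewrite ler_pdivrMl//; apply: ple; first exact: mulr_gt0.
  by rewrite invfM mulrC -scalerA (scalerA _ t) mulVf ?gt_eqF// scale1r.
have pZE t x : 0 < t -> p (t *: x) = t * p x.
  move=> t0; apply/eqP; rewrite eq_le pZ//= -ler_pdivlMl//.
  by rewrite (le_trans _ (pZ _ _ _)) ?invr_gt0// scalerA mulVf ?gt_eqF// scale1r.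
have p0 : p 0 = 0.
  by have := pZE 2 0 ltac:(lra); rewrite scaler0; lra.
exists p; split; [split=> [x y|t x]| |].
- suff : p (x + y) - p y <= p x by rewrite lerBlDr.
  apply: (lep _ _) => s s0 Vs; suff : p (x + y) - s <= p y by rewrite lerBlDr lerBlDl.
  apply: (lep _ _) => t t0 Vt; rewrite lerBlDl; apply: ple; first exact: addr_gt0.
  have st0 : 0 < s + t by exact: addr_gt0.
  (* [(x + y) / (s + t)] is the convex combination of [x / s] and [y / t] with weights [s / (s + t)]
     and [t / (s + t)]. *)
  have := cV _ _ (s / (s + t)) _ _ Vs Vt.
  have -> : 1 - s / (s + t) = t / (s + t) by field; lra.
  rewrite !scalerA [s / _ / s]mulrAC [t / _ / t]mulrAC !divff ?gt_eqF// !mul1r scalerDr.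
  apply; first by rewrite divr_ge0// ltW.
  by rewrite ler_pdivrMr// mul1r lerDl ltW.
- by rewrite le0r => /predU1P[->|]; [rewrite scale0r mul0r|exact: pZE].
- by move=> x Vx; apply: ple => //; rewrite invr1 scale1r.
- move=> x nVx; apply: (lep _ _) => t t0 Vt; rewrite leNgt; apply/negP => t1.
  apply: nVx; have := cV _ _ t (ltW t0) (ltW t1) Vt V00.
  by rewrite scaler0 addr0 scalerA divff ?gt_eqF// scale1r.
Qed.

(** The one-sided bound becomes two-sided on the intersection of [V] with its opposite. *)
Lemma linear_continuous_bounded (f : {linear E -> R^o}) V : nbhs 0 V ->
  (forall v, V v -> f v <= 1) -> continuous f.
Proof.
move=> V0 fV x; apply/cvgrPdist_le => /= e e0.
have NV0 : nbhs 0 [set v | V (- v)].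
  by have := nbhs0N V0; apply: filterS => _ [v Vv <-]; rewrite /= opprK.
have : nbhs 0 ((V `&` [set v | V (- v)]) : set E) by exact: filterI.
move=> /(@nbhs0_scale e^-1); rewrite invr_eq0 gt_eqF// => /(_ isT).
move=> /(nbhs_translate x); apply: filterS => y /= [/fV + /fV].
rewrite -scalerN !linearZ/= !ler_pdivrMl// mulr1 opprB !linearB/= => fxy fyx.
by rewrite ler_norml fyx andbT lerNl opprB.
Qed.

Lemma convex_separation V z : nbhs 0 V -> convex_set V -> ~ V z ->
  exists f : {linear E -> R^o}, [/\ continuous f,
    forall v, V v -> f v <= 1 & 1 <= f z].
Proof.
move=> V0 cV nVz; have [p [pP pV pnV]] := minkowski_sublinear V0 cV.
have [f [fp fz]] := hahn_banach z pP.
have fV v : V v -> f v <= 1 by move=> /pV; exact: le_trans.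
exists f; split=> //; first exact: linear_continuous_bounded V0 fV.
exact: le_trans (pnV _ nVz) fz.
Qed.

Lemma functional_neq0 x : hausdorff_space E -> x != 0 ->
  exists f : {linear E -> R^o}, continuous f /\ 1 <= f x.
Proof.
move=> hE x0; have [U [U0 nUx]] : exists U, nbhs 0 U /\ ~ U x.
  apply: contrapT => /forallNP h; move/eqP: x0; apply.
  apply: hausdorff_nbhs0 => // U U0; apply: contrapT => nUx.
  by apply: (h U).
have [V [V0 cV VU]] := nbhs0_convex U0.
have [|f [cf _ fx]] := convex_separation (z := x) V0 cV; first by move/VU.
by exists f.
Qed.

End locally_convex.

(** * Barycenters in compact convex sets *)

Section barycenter.
Context (R : realType) (E : tvsType R).
Variables (C : set E) (J : (E -> R) -> R).
Hypothesis J_lin : forall (a : R) (f g : {linear E -> R^o}),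
  continuous f -> continuous g ->
  J (fun x => a * f x + g x) = a * J f + J g.
Hypothesis J_ge : forall (f : {linear E -> R^o}) (m : R), continuous f ->
  (forall x, C x -> m <= f x) -> m <= J f.

Let J_sum (f : nat -> {linear E -> R^o}) (d : nat -> R) n :
  (forall i, continuous (f i)) ->
  exists g : {linear E -> R^o}, [/\ continuous g,
    forall x, g x = \sum_(i < n) d i * f i x &
    J g = \sum_(i < n) d i * J (f i)].
Proof.
move=> cf; elim: n => [|n [g [cg gE Jg]]].
  pose z : {linear E -> R^o} := \0.
  exists z; split; [by move=> x; exact: cst_continuous|by move=> x; rewrite big_ord0|].
  (* [J] vanishes at the zero functional, written as [- f + f]. *)
  rewrite big_ord0; have := J_lin (- 1) (cf 0%N) (cf 0%N).
  rewrite mulN1r addNr => <-; congr J; apply/funext => x.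
  by rewrite mulN1r addNr.
pose h : {linear E -> R^o} := d n \*: f n \+ g.
exists h; split=> [x|x|] /=.
- apply: (@cvgD _ R^o); last exact: cg.
  by apply: (@cvgM R); [exact: cvg_cst|exact: cf].
- by rewrite big_ord_recr/= addrC gE.
- by rewrite big_ord_recr/= addrC -Jg -J_lin.
Qed.

(* At a point [c0] of [C] minimising [\sum_i (f_i c - J f_i) ^ 2] the functional
   [\sum_i (f_i c0 - J f_i) f_i] is minimal on [C]; comparing its [J] with this
   minimum shows that the sum of squares vanishes. *)
Let J_finite (f : nat -> {linear E -> R^o}) n : compact C -> convex_set C ->
  C !=set0 -> (forall i, continuous (f i)) ->
  exists2 c, C c & forall i, (i < n)%N -> f i c = J (f i).
Proof.
move=> cC /convex_setP vC C0 cf.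
pose q c : R := \sum_(i < n) (f i c - J (f i)) ^+ 2.
have cq : continuous q.
  move=> c; rewrite /q; apply: cvg_big => [|i _]; first exact: add_continuous.
  by apply: (@cvgM R); apply: (@cvgB _ R^o); [exact: cf|exact: cvg_cst|exact: cf|exact: cvg_cst].
have [c0 /set_mem Cc0 qc0] : exists2 c, c \in C & forall t, t \in C -> q c <= q t.
  by apply: compact_EVT_min => //; exact: continuous_subspaceT.
pose d i : R := f i c0 - J (f i).
have [g [cg gE Jg]] := J_sum d n cf.
have ming c : C c -> g c0 <= g c.
  move=> Cc; pose u i : R := f i c - f i c0.
  pose A := \sum_(i < n) d i * u i; pose B := \sum_(i < n) u i ^+ 2.
  have B0 : 0 <= B by apply: sumr_ge0 => i _; exact: sqr_ge0.
  suff A0 : 0 <= A.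
    rewrite -subr_ge0 !gE -sumrB (le_trans A0)//; apply: ler_sum => i _.
    by rewrite mulrBr.
  (* First-order optimality at [c0]: the right-hand side is the increase of [q] from [c0] to
     [t *: c + (1 - t) *: c0]. For [A < 0] the [t] chosen below satisfies [t * B < - A] and makes it
     negative. *)
  have AB t : 0 <= t -> t <= 1 -> 0 <= t * (2 * A + t * B).
    move=> t0 t1; have := vC c c0 t t0 t1 Cc Cc0 => /mem_set/qc0.
    rewrite -subr_ge0; congr (_ <= _).
    rewrite /q -sumrB /A /B !mulr_sumr -big_split/= mulr_sumr; apply: eq_bigr => i _.
    rewrite (functionalD (f i)) !(functionalZ (f i)) /d /u; ring.
  rewrite leNgt; apply/negP => A0.
  pose t := Num.min 1 (- A / (B + 1)).
  have t0 : 0 < t by rewrite lt_min ltr01 divr_gt0; lra.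
  have t1 : t <= 1 by rewrite ge_min lexx.
  have tB : t * (B + 1) <= - A.
    by rewrite -ler_pdivlMr ?ltr_wpDl// ge_min lexx orbT.
  have := AB t (ltW t0) t1; rewrite pmulr_rge0//; lra.
have := J_ge cg ming; rewrite gE Jg -subr_le0 -sumrB => dle.
exists c0 => // i ni; apply/eqP; rewrite -subr_eq0 -sqrf_eq0 -[_ - _]/(d i).
have: \sum_(i < n) d i ^+ 2 <= 0.
  by apply: le_trans dle; apply: ler_sum => j _; rewrite -mulrBr expr2.
have dd0 : forall j : 'I_n, true -> 0 <= d j ^+ 2 by move=> j _; exact: sqr_ge0.
move=> dle0; have /eqP : \sum_(i < n) d i ^+ 2 = 0.
  by apply/eqP; rewrite eq_le dle0 sumr_ge0.
by rewrite psumr_eq0// => /allP/(_ (Ordinal ni)) /=; rewrite mem_index_enum; exact.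
Qed.

(** By [J_finite] the solution sets in [C] of finitely many equations [f c = J f] generate a proper
    filter. A cluster point solves all the equations, since [f x != J f] is an open condition. *)
Lemma barycenter : compact C -> convex_set C -> C !=set0 ->
  exists2 c, C c & forall f : {linear E -> R^o}, continuous f -> f c = J f.
Proof.
move=> cC vC C0.
pose F : set_system E := fun A => exists n (f : nat -> {linear E -> R^o}),
  (forall i, continuous (f i)) /\
  forall c, C c -> (forall i, (i < n)%N -> f i c = J (f i)) -> A c.
pose z : {linear E -> R^o} := \0.
have cz : continuous z by move=> x; exact: cst_continuous.
have FF : ProperFilter F.
  split.
    move=> [n [f [cf]]]; have [c Cc fc] := J_finite n cC vC C0 cf.
    by move=> /(_ c Cc fc).
  split.
  - by exists 0%N, (fun=> z).
  - move=> A B [n [f [cf fA]]] [m [g [cg gB]]].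
    exists (n + m)%N, (fun i => if (i < n)%N then f i else g (i - n)%N); split.
      by move=> i; case: ifP.
    move=> c Cc fg; split; [apply: fA|apply: gB] => // i ni.
      by have := fg i (ltn_addr _ ni); rewrite ni.
    by have := fg (n + i)%N; rewrite ltn_add2l ni ltnNge leq_addr/= addKn => ->.
  - by move=> A B AB [n [f [cf fA]]]; exists n, f; split=> // c Cc /(fA c Cc)/AB.
have FC : F C by exists 0%N, (fun=> z).
have [c [Cc Fc]] := cC F FF FC.
exists c => // f cf; apply: contrapT => fcJ.
have FfJ : F [set x | f x = J f] by exists 1%N, (fun=> f); split=> // x _ /(_ 0%N); exact.
have : nbhs c [set x | f x != J f].
  apply: (cf c [set y : R^o | y != J f]).
  apply: open_nbhs_nbhs; split; last exact/eqP.
  exact: (@open_neq R (J f)).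
by move=> /(Fc _ _ FfJ)[x [/= -> /eqP]].
Qed.

End barycenter.

(** * Metrizability of compact sets *)

Lemma invn_lt (R : realType) (e : R) : 0 < e ->
  exists N, forall n, (N <= n)%N -> n.+1%:R^-1 < e.
Proof.
move=> e0; have := @archi_boundP _ e^-1; rewrite invr_ge0 (ltW e0) => /(_ isT).
set N := Num.bound _ => eN; exists N => n Nn.
by rewrite -[ltRHS]invrK ltf_pV2 ?posrE ?invr_gt0// (lt_le_trans eN)// ler_nat ltnW.
Qed.

Section metrizability.
Context (R : realType).

(** [U (n, m)] is the ball of radius [n.+1%:R^-1] about the [m]-th centre of a finite net. Balls are
    written as implications, hence contain the complement of [K], so that they are neighbourhoods in
    [X] and their interiors can cover [K]. *)
Lemma compact_metrizable_base (X : ptopologicalType) (K : set X) :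
  compact K -> metrizable R K -> exists U : nat * nat -> set X,
    forall x A, K x -> within K (nbhs x) A ->
      exists i, U i x /\ K `&` U i `<=` A.
Proof.
move=> cK [d [d0 deq dC dD dn]].
pose B n x := [set y | K y -> d x y < n.+1%:R^-1].
have BK n x : K x -> nbhs x (B n x).
  by move=> Kx; apply/(dn x Kx); exists n.+1%:R^-1.
have /choice[D DK] : forall n, exists s : seq X, (forall x, x \in s -> K x) /\
    (forall y, K y -> exists2 x, x \in s & B n x y).
  move=> n; move: cK; rewrite compact_cover => /(_ _ K (fun x => interior (B n x))).
  case=> [x _|x Kx|D DK KD]; first exact: open_interior.
    by exists x => //; exact: BK.
  exists (finmap.enum_fset D); split=> [x /DK /set_mem//|y /KD[x xD /interior_subset yB]].
  by exists x.
exists (fun i => B i.1 (nth point (D i.1) i.2)) => x A Kx /(dn x Kx)[e e0 eA].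
have [n ne] : exists n, 2 * n.+1%:R^-1 < e.
  have [|N /(_ N (leqnn N)) Ne] := @invn_lt R (e / 2); first by rewrite divr_gt0.
  by exists N; rewrite mulrC -ltr_pdivlMr.
have [c cD Bcx] := (DK n).2 x Kx; have Kc := (DK n).1 c cD.
exists (n, index c (D n)); rewrite /= nth_index//; split=> // y [Ky /(_ Ky) dcy].
apply: eA => //; rewrite (le_lt_trans (dD x c y Kx Kc Ky))// dC//.
have dcx : d c x < n.+1%:R^-1 := Bcx Kx.
have := ltrD dcx dcy; rewrite -mulr2n -[_ *+ 2]mulr_natl.
by move=> /lt_trans; apply.
Qed.

(** The metric is the supremum of the truncated differences [|f n x - f n y|] divided by [n.+1]. Its
    balls are neighbourhoods because only finitely many indices matter at a given scale; compactness
    gives the converse. *)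
Lemma metrizable_of_separating (T : topologicalType) (S : set T)
    (f : nat -> T -> R) : compact S -> (forall n, continuous (f n)) ->
  (forall x y, S x -> S y -> (forall n, f n x = f n y) -> x = y) ->
  metrizable R S.
Proof.
move=> cS cf fS.
pose D x y := [set Num.min 1 `|f n x - f n y| / n.+1%:R | n in setT].
pose d x y := sup (D x y).
have w0 n : 0 < n.+1%:R^-1 :> R by [].
have w1 n : n.+1%:R^-1 <= 1 :> R by rewrite invf_le1// ler1n.
have m0 n x y : 0 <= Num.min 1 `|f n x - f n y| by rewrite le_min ler01/=.
have uD x y : ubound (D x y) 1.
  move=> _ [n _ <-]; rewrite ler_pdivrMr// mul1r.
  by rewrite (@le_trans _ _ 1)// ?ge_min ?lexx// ler1n.
have hD x y : has_sup (D x y).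
  by split; [exists (Num.min 1 `|f 0%N x - f 0%N y| / 1%:R), 0%N|exists 1].
have led n x y : Num.min 1 `|f n x - f n y| / n.+1%:R <= d x y.
  by apply: ub_le_sup; [exists 1|exists n].
have dle x y c : (forall n, Num.min 1 `|f n x - f n y| / n.+1%:R <= c) -> d x y <= c.
  by move=> h; apply: ge_sup; [exact: (hD x y).1|move=> _ [n _ <-]].
have d_ge0 x y : 0 <= d x y by rewrite (le_trans _ (led 0%N x y))// divr_ge0.
have d_eq0 x y : S x -> S y -> d x y = 0 -> x = y.
  move=> Sx Sy dxy; apply: fS => // n; apply/eqP; rewrite -subr_eq0 -normr_eq0.
  have := led n x y; rewrite dxy pmulr_lle0// ge_min leNgt ltr01/= => h.
  by rewrite eq_le h normr_ge0.
have dC x y : d x y = d y x.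
  by congr sup; apply/seteqP; split=> _ [n _ <-]; exists n => //; rewrite distrC.
have dD x y z : d x z <= d x y + d y z.
  apply: (dle) => n; apply: (@le_trans _ _
    ((Num.min 1 `|f n x - f n y| + Num.min 1 `|f n y - f n z|) / n.+1%:R)).
    rewrite ler_pM2r//; have := ler_distD (f n y) (f n x) (f n z).
    have := normr_ge0 (f n x - f n y); have := normr_ge0 (f n y - f n z).
    by rewrite /Num.min; do 3 case: ltP => ?; lra.
  by rewrite mulrDl lerD.
exists d; split=> //.
- move=> x y Sx Sy; split; first exact: d_eq0.
  move=> ->; apply/eqP; rewrite eq_le d_ge0 andbT; apply: (dle) => n.
  by rewrite subrr normr0 min_r// mul0r.
- move=> x Sx A; split=> [xA|[e e0 eA]]; last first.
    have e20 : 0 < e / 2 by lra.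
    have [N Ne] := invn_lt e20.
    have /= near_f M : \forall y \near x, forall n, (n < M)%N -> `|f n x - f n y| <= e / 2.
      elim: M => [|M IH]; first exact: nearW.
      have /cvgrPdist_le/(_ _ e20) fM := cf M x.
      apply: filterS2 IH fM => y IH fM n; rewrite ltnS leq_eqVlt => /predU1P[->|]//.
      exact: IH.
    apply: filterS (near_f N) => y fN Sy; apply: eA => //.
    suff : d x y <= e / 2 by lra.
    apply: (dle) => n; have [nN|Nn] := ltnP n N.
      rewrite -[leRHS]mulr1; apply: ler_pM; [exact: m0|exact/ltW| |exact: w1].
      by rewrite ge_min fN ?orbT.
    rewrite -[leRHS]mul1r; apply: ler_pM; [exact: m0|exact/ltW| |exact/ltW/Ne].
    by rewrite ge_min lexx.
  (* If no ball about [x] lay in [A], the parts of the balls outside [A] would cluster at some [z]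
     in [S]. Every [f n] agrees at [x] and [z], so [z = x], although [A] is a neighbourhood of [x]
     within [S]. *)
  apply: contrapT => nA.
  pose F := filter_from [set e : R | 0 < e] (fun e => [set y | [/\ S y, d x y < e & ~ A y]]).
  have FF : ProperFilter F.
    apply: filter_from_proper; last first.
      move=> e e0; apply: contrapT => /set0P/negP/negPn/eqP h; apply: nA.
      exists e => // y Sy dxy; apply: contrapT => nAy.
      by have : [set y | [/\ S y, d x y < e & ~ A y]] y by []; rewrite h.
    apply: filter_from_filter; first by exists 1 => /=.
    move=> e1 e2 /= e10 e20; exists (Num.min e1 e2); first by rewrite /= lt_min e10.
    by move=> y [Sy + nAy]; rewrite lt_min => /andP[].
  have [z [Sz Fz]] : S `&` cluster F !=set0 by apply: cS => //; exists 1 => //= y [].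
  have xz : x = z.
    apply: fS => // n; apply/eqP; rewrite -subr_eq0 -normr_eq0; apply/negPn/negP.
    rewrite -normr_gt0 normr_id => fn0.
    pose r := `|f n x - f n z|; have r0 : 0 < r by [].
    have /cvgrPdist_lt/(_ (r / 2)) := cf n z; rewrite divr_gt0// => /(_ isT) nz.
    have [|y [[Sy dxy _] /= fy]] :=
        Fz [set y | [/\ S y, d x y < Num.min 1 (r / 2) / n.+1%:R & ~ A y]] _ _ nz.
      exists (Num.min 1 (r / 2) / n.+1%:R) => //=.
      by rewrite divr_gt0// lt_min ltr01 divr_gt0.
    have := le_lt_trans (led n x y) dxy; rewrite ltr_pM2r// ltNge le_min !ge_min lexx/=.
    have := ler_distD (f n y) (f n x) (f n z); rewrite -/r [`|f n y - _|]distrC => h.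
    have rf : r / 2 <= `|f n x - f n y| by lra.
    by rewrite rf orbT.
  have : F [set y | [/\ S y, d x y < 1 & ~ A y]] by exists 1 => //=.
  by rewrite xz in xA *; move=> /Fz /(_ xA)[y [[Sy _ nAy] /(_ Sy)]].
Qed.

End metrizability.

(** * Countable networks and compact unions *)

Section networks.
Context (R : realType) (E : tvsType R).

(** A network in the sense of general topology: the members need not be open, so that continuous
    images of bases are allowed. *)
Definition network (I : Type) (S : set E) (N : I -> set E) :=
  forall x A, S x -> nbhs x A -> exists i, N i x /\ N i `<=` A.

Lemma network_image (X : ptopologicalType) (K : set X) (g : X -> E) (a : R) :
  compact K -> metrizable R K -> {within K, continuous g} ->
  exists N : nat * nat -> set E, network [set a *: g x | x in K] N.
Proof.
move=> cK mK gK; have [U UK] := compact_metrizable_base cK mK.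
exists (fun i => [set a *: g x | x in K `&` U i]) => _ A [x Kx <-] gA.
have [|i [Uix UA]] := UK x [set y | A (a *: g y)] Kx.
  by move/nbhs_scale : gA => /(gK x); rewrite nbhs_subspace_in.
exists i; split; first by exists x.
by move=> _ [y [Ky Uy] <-]; exact: UA.
Qed.

(** One functional is selected for each pair of members that some functional separates, and 0 for
    the other pairs. If [h] separates [x] from [y], it separates members of the network around them,
    so the functional selected for that pair distinguishes [x] from [y]. *)
Lemma network_separating (I : choiceType) (S : set E) (N : I -> set E) :
  hausdorff_space E -> network S N ->
  exists f : I * I -> {linear E -> R^o}, (forall k, continuous (f k)) /\
    forall x y, S x -> S y -> (forall k, f k x = f k y) -> x = y.
Proof.
move=> hE NS.
pose z : {linear E -> R^o} := \0.
have cz : continuous z by move=> x; exact: cst_continuous.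
pose P (k : I * I) (f : {linear E -> R^o}) := continuous f /\
  ((exists f' : {linear E -> R^o}, continuous f' /\
      forall u v, N k.1 u -> N k.2 v -> f' u < f' v) ->
    forall u v, N k.1 u -> N k.2 v -> f u < f v).
have /choice[f fP] : forall k, exists f, P k f.
  move=> k.
  have [[f' [cf' f'N]]|nf] := pselect (exists f' : {linear E -> R^o}, continuous f' /\
      forall u v, N k.1 u -> N k.2 v -> f' u < f' v).
    by exists f'.
  by exists z; split.
exists f; split=> [k|x y Sx Sy fxy]; first exact: (fP k).1.
apply/eqP; rewrite eq_sym -subr_eq0; apply/negPn/negP => yx0.
have [h [ch hyx]] := functional_neq0 hE yx0.
have hx : nbhs x [set u | h u < h x + 2^-1].
  have /cvgrPdist_lt/(_ 2^-1) := ch x; rewrite invr_gt0 ltr0n => /(_ isT).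
  by apply: filterS => u /=; rewrite ltr_norml; lra.
have hy : nbhs y [set u | h y - 2^-1 < h u].
  have /cvgrPdist_lt/(_ 2^-1) := ch y; rewrite invr_gt0 ltr0n => /(_ isT).
  by apply: filterS => u /=; rewrite ltr_norml; lra.
have [i [Nix Nih]] := NS x _ Sx hx; have [j [Njy Njh]] := NS y _ Sy hy.
suff : f (i, j) x < f (i, j) y by rewrite fxy ltxx.
apply: ((fP (i, j)).2 _ x y Nix Njy).
exists h; split=> // u v /Nih /= hu /Njh /= hv.
by move: hyx; rewrite functionalB; lra.
Qed.

Lemma network_metrizable (I : countType) (S : set E) (N : I -> set E) :
  hausdorff_space E -> compact S -> network S N -> metrizable R S.
Proof.
move=> hE cS NS; have [f [cf fS]] := network_separating hE NS.
apply: (@metrizable_of_separating _ _ _ (fun n =>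
    if unpickle n is Some k then f k : E -> R else fun=> 0)) => //.
  by move=> n; case: unpickle => [k|]; [exact: cf|move=> x; exact: cst_continuous].
by move=> x y Sx Sy fxy; apply: fS => // k; have := fxy (pickle k); rewrite pickleK.
Qed.

(** A filter on the union that does not cluster at 0 contains a set missing a neighbourhood of 0, so
    it lives on finitely many of the [K n]. *)
Lemma compact_null_union (K : nat -> set E) : (forall n, compact (K n)) ->
  (forall U, nbhs 0 U -> exists N, forall n, (N <= n)%N -> K n `<=` U) ->
  compact (0 |` \bigcup_n K n).
Proof.
move=> cK K0 F FF FK; apply: contrapT => nF.
have [A [U [FA U0 AU]]] : exists A U, [/\ F A, nbhs 0 U & A `&` U = set0].
  apply: contrapT => h; apply: nF; exists 0; split; first by left.
  move=> A U FA U0; apply/set0P/negP => /eqP AU; apply: h.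
  by exists A, U.
have [N KU] := K0 U U0.
have cN : compact (\big[setU/set0]_(n < N) K n) by apply: bigsetU_compact.
have [|x [Kx Fx]] := cN F FF.
  apply: filterS (filterI FA FK) => x [Ax [x0|[n _ Knx]]].
    have {}x0 : x = 0 by [].
    by suff : set0 x by []; rewrite -AU; split=> //; rewrite x0; exact: nbhs_singleton.
  rewrite -bigcup_mkord; have [nN|Nn] := ltnP n N; first by exists n.
  by suff : set0 x by []; rewrite -AU; split=> //; exact: (KU n).
apply: nF; exists x; split=> //; right.
by move: Kx; rewrite -bigcup_mkord => -[n _ Knx]; exists n.
Qed.

End networks.

(** * Exhaustion of the measure space *)

Section gauges.
Context (R : realType) (E : tvsType R) (D : set E).

Lemma gauge_ge0 e : (0 <= gauge_functional D e)%E.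
Proof. by apply: le_ereal_inf_tmp => _ [t [/ltW t0 _] <-]; rewrite lee_fin. Qed.

(** The infimum need not be attained, but a strict bound yields some [t < b] with [e] in [t *: D],
    and the factor [t / b] is absorbed by [D]. *)
Lemma gauge_lt e (b : R) : absolutely_convex D -> (gauge_functional D e < b%:E)%E ->
  exists2 v, D v & e = b *: v.
Proof.
move=> [_ _ aD] /ereal_inf_lt[_ [t [t0 [v Dv <-]] <-]]; rewrite lte_fin => tb.
have b0 : 0 < b by exact: lt_trans tb.
exists ((t / b) *: v); last by rewrite scalerA mulrCA divff ?gt_eqF// mulr1.
by apply: aD => //; rewrite ger0_norm ?divr_ge0 ?ltW// ltr_pdivrMr// mul1r.
Qed.

Lemma bounded_scale_nbhs0 U : tvs_bounded D -> nbhs 0 U ->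
  exists2 r : R, 0 < r & forall s v, 0 < s -> s <= r -> D v -> U (s *: v).
Proof.
move=> bD /bD[r r0 rD]; exists r^-1; first by rewrite invr_gt0.
move=> s v s0 sr Dv; have [|u Uu <-] := rD s^-1 _ v Dv.
  by rewrite gtr0_norm ?invr_gt0// -[leLHS]invrK lef_pV2 ?posrE ?invr_gt0.
by rewrite scalerA divff ?gt_eqF// scale1r.
Qed.

Lemma gauge_eq0 e : hausdorff_space E -> absolutely_convex D -> tvs_bounded D ->
  gauge_functional D e = 0%E -> e = 0.
Proof.
move=> hE aD bD g0; apply: hausdorff_nbhs0 => // U U0.
have [r r0 rU] := bounded_scale_nbhs0 bD U0.
have [|v Dv ->] := @gauge_lt e r aD; first by rewrite g0 lte_fin.
exact: rU.
Qed.

End gauges.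

(* With [r n] the [n]-th remainder of the series of the [c n + 2 ^- n], the terms
   [c n / sqrt (r n)] are bounded by [2 (sqrt (r n) - sqrt (r n.+1))]. *)
Lemma slowly_vanishing_weights (R : realType) (c : nat -> R) (M : R) :
  (forall n, 0 <= c n) -> (forall n, \sum_(i < n) c i <= M) ->
  exists eps : nat -> R, [/\ forall n, 0 < eps n,
    forall d, 0 < d -> exists N, forall n, (N <= n)%N -> eps n <= d &
    exists M', forall n, \sum_(i < n) c i / eps i <= M'].
Proof.
(* The added geometric term makes every remainder [r n] strictly positive, even when the [c n]
   vanish eventually. *)
move=> c0 cM; pose b n : R := c n + 2^-1 ^+ n.
have b0 n : 0 < b n by rewrite ltr_wpDl// exprn_gt0// invr_gt0.
pose s n := \sum_(i < n) b i.
have sS n : s n.+1 = s n + b n by rewrite /s big_ord_recr.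
have geo n : \sum_(i < n) (2^-1 : R) ^+ i = 2 - 2 * 2^-1 ^+ n.
  elim: n => [|n IH]; first by rewrite big_ord0 expr0 mulr1 subrr.
  by rewrite big_ord_recr/= IH exprS; field.
have sM n : s n <= M + 2.
  rewrite /s big_split/= geo; have := cM n.
  have : 0 <= (2^-1 : R) ^+ n by rewrite exprn_ge0// invr_ge0.
  lra.
have hs : has_sup (range s) by split; [exists (s 0%N), 0%N|exists (M + 2) => _ [n _ <-]].
pose L := sup (range s); pose r n := L - s n.
have sL n : s n <= L by apply: ub_le_sup; [exact: hs.2|exists n].
have r0 n : 0 < r n by have := sL n.+1; have := b0 n; rewrite sS /r; lra.
have rS n : r n.+1 = r n - b n by rewrite /r sS; lra.
have r_noninc m n : (m <= n)%N -> r n <= r m.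
  elim: n => [|n IH]; first by rewrite leqn0 => /eqP ->.
  rewrite leq_eqVlt => /predU1P[->//|]; rewrite ltnS => /IH.
  by have := b0 n; rewrite rS; lra.
exists (fun n => Num.sqrt (r n)); split.
- by move=> n; rewrite sqrtr_gt0.
- move=> d d0; have [|_ [N _ <-] sN] := sup_adherent (eps := d ^+ 2) _ hs.
    by rewrite exprn_gt0.
  exists N => n Nn; rewrite -[leRHS](gtr0_norm d0) -sqrtr_sqr.
  rewrite ler_sqrt ?exprn_ge0 ?ltW//; have := r_noninc _ _ Nn.
  by move: sN; rewrite -/L /r; lra.
- exists (2 * Num.sqrt (r 0%N)) => n.
  suff : \sum_(i < n) c i / Num.sqrt (r i) <= 2 * Num.sqrt (r 0%N) - 2 * Num.sqrt (r n).
    by have := sqrtr_ge0 (r n); lra.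
  elim: n => [|n IH]; first by rewrite big_ord0 subrr.
  rewrite big_ord_recr/=; suff : c n / Num.sqrt (r n) <= 2 * Num.sqrt (r n) - 2 * Num.sqrt (r n.+1).
    by lra.
  (* [b n = r n - r n.+1] is the product of the difference and the sum of the two square roots, and
     that sum is at most [2 * Num.sqrt (r n)]. *)
  have q0 : 0 < Num.sqrt (r n) by rewrite sqrtr_gt0.
  rewrite ler_pdivrMr//.
  have qn := sqr_sqrtr (ltW (r0 n)); have qn1 := sqr_sqrtr (ltW (r0 n.+1)).
  have cb : c n <= b n by rewrite lerDl exprn_ge0// invr_ge0.
  have q1 := sqrtr_ge0 (r n.+1).
  have qq : Num.sqrt (r n.+1) <= Num.sqrt (r n) by apply: ler_wsqrtr; exact: r_noninc.
  move: qn qn1; rewrite rS !expr2; nra.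
Qed.

(** * Sets and constants under the completion of a measure *)

Section completions.
Context d (T : measurableType d) (R : realType) (mu : {measure set T -> \bar R}).

Lemma completion_measurable (A : set T) : measurable A ->
  measurable (A : set (completion_type mu)).
Proof.
move=> mA; rewrite completion_measurableE; exists A => //.
by exists set0; [exact: negligible_set0|rewrite setU0].
Qed.

Lemma completion_negligible (N : set T) : mu.-negligible N ->
  measurable (N : set (completion_type mu)).
Proof.
move=> nN; rewrite completion_measurableE; exists set0 => //.
by exists N => //; rewrite set0U.
Qed.

Lemma completion_eq (A : set T) : measurable A -> completion mu A = mu A.
Proof. by move=> mA; rewrite -[A]setU0 completionE ?setU0//; exact: negligible_set0. Qed.

Lemma completion_integral_cst (A : set T) (r : \bar R) : measurable A ->
  (\int[completion mu]_(x in A) cst r x = r * mu A)%E.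
Proof.
move=> mA; rewrite integral_cst; last exact: completion_measurable.
by congr (_ * _)%E; exact: completion_eq.
Qed.

Lemma completion_eq0 (N : set T) : mu.-negligible N -> completion mu N = 0%E.
Proof. by move=> nN; rewrite -[N]set0U completionE// measure0. Qed.

Lemma completion_measurable_ex (S : set T) :
  measurable (S : set (completion_type mu)) ->
  exists A N, [/\ measurable A, mu.-negligible N, S = A `|` N &
    completion mu S = mu A].
Proof.
rewrite completion_measurableE => -[A mA [N nN <-]].
by exists A, N; split=> //; rewrite completionE.
Qed.

Lemma completion_null (S : set T) :
  measurable (S : set (completion_type mu)) -> completion mu S = 0%E ->
  mu.-negligible S.
Proof.
move=> /completion_measurable_ex[A [N [mA nN -> ->]]] A0.
by apply: negligibleU => //; exists A; split.
Qed.

End completions.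

Section exhaustion.
Context (R : realType) (E : tvsType R) (X : ptopologicalType).
Context (nu : {measure set (borel_type X) -> \bar R}) (g : X -> E).
Hypotheses (rnu : metrically_regular nu) (lg : lusin_measurable nu g).

Definition carrier_piece (K : set X) :=
  [/\ measurable (K : set (borel_type X)), compact K, metrizable R K &
      {within K, continuous g}].

(** Lusin measurability is applied to [A] and then metric regularity to the compact set so found,
    each losing at most [e / 2]; continuity of [g] passes to the smaller set. *)
Lemma carrier_piece_approx (A : set (borel_type X)) (e : R) : measurable A ->
  (nu A < +oo)%E -> 0 < e ->
  exists K, [/\ carrier_piece K, K `<=` A & (nu A <= nu K + e%:E)%E].
Proof.
move=> mA A_fin e0; have e20 : 0 < e / 2 by lra.
have fin B : measurable B -> B `<=` A -> (nu B \is a fin_num)%E.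
  move=> mB BA; rewrite ge0_fin_numE//; apply: le_lt_trans A_fin.
  by apply: le_measure => //; rewrite inE.
have adh (S : set (\bar R)) v : v \is a fin_num -> v = ereal_sup S ->
    exists2 x, S x & (v - (e / 2)%:E < x)%E.
  by move=> vfin vE; rewrite vE; apply: ub_ereal_sup_adherent => //; rewrite -vE.
have [_ [K1 [mK1 K1A cK1 gK1] <-] AK1] := adh _ _ (fin _ mA (@subset_refl _ A)) (lg mA).
have K1fin := fin _ mK1 K1A.
have [_ [K2 [mK2 K21 cK2 mtK2] <-] K12] := adh _ _ K1fin (rnu mK1).
have K2A := subset_trans K21 K1A; have K2fin := fin _ mK2 K2A.
exists K2; split=> //; first by split=> //; exact: continuous_subspaceW gK1.
move: AK1 K12; rewrite -(fineK K1fin) -(fineK K2fin) -(fineK (fin _ mA (@subset_refl _ A))).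
by rewrite -!EFinB !lte_fin -EFinD lee_fin; lra.
Qed.

Lemma carrier_exhaustion (A : set (borel_type X)) : measurable A ->
  (nu A < +oo)%E ->
  exists K : nat -> set X, (forall i, carrier_piece (K i) /\ K i `<=` A) /\
    nu.-negligible (A `\` \bigcup_i K i).
Proof.
move=> mA A_fin.
have /choice[K KP] : forall n, exists K, [/\ carrier_piece K, K `<=` A &
    (nu A <= nu K + n.+1%:R^-1%:E)%E].
  by move=> n; apply: carrier_piece_approx.
have mK n : measurable (K n : set (borel_type X)) by have [[]] := KP n.
exists K; split=> [i|]; first by have [] := KP i.
have mU : measurable (A `\` \bigcup_i K i : set (borel_type X)).
  by apply: measurableD => //; exact: bigcupT_measurable.
exists (A `\` \bigcup_i K i); split=> //.
have le_n n : (nu (A `\` \bigcup_i K i : set (borel_type X)) <= n.+1%:R^-1%:E)%E.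
  have [_ KA AK] := KP n.
  apply: (@le_trans _ _ (nu (A `\` K n : set (borel_type X)))).
    apply: le_measure; rewrite ?inE//; first exact: measurableD.
    by apply: setDS => x Kx; exists n.
  rewrite measureD// (setIidr KA) leeBlDl//.
  rewrite ge0_fin_numE//; apply: le_lt_trans A_fin.
  by apply: le_measure => //; rewrite inE.
apply/eqP; rewrite eq_le measure_ge0 andbT leNgt; apply/negP => U0.
have U_fin : nu (A `\` \bigcup_i K i : set (borel_type X)) \is a fin_num.
  by rewrite ge0_fin_numE// (le_lt_trans (le_n 0%N))// ltry.
move: U0 le_n; rewrite -(fineK U_fin); set u := fine _; rewrite lte_fin => u0 le_n.
have [n /(_ n (leqnn n)) un] := invn_lt u0.
by have := le_n n; rewrite lee_fin leNgt un.
Qed.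

Variable D : set E.
Hypotheses (hE : hausdorff_space E) (bD : tvs_bounded D) (aD : absolutely_convex D).
Let phi x := gauge_functional D (g x).
Hypotheses (mphi : measurable_fun (setT : set (completion_type nu)) phi).
Hypotheses (phi_fin : (\int[completion nu]_x phi x < +oo)%E).

Let phi_ge0 x : (0 <= phi x)%E. Proof. exact: gauge_ge0. Qed.

(** These shells replace sigma-finiteness of [nu]: by Markov's inequality each has finite measure,
    and together they cover the points where [phi] is positive and finite. Where [phi] is 0 so is
    [g], and [phi] is infinite on a null set only. *)
Let level (k : int) : set X :=
  [set x | ((expR k%:~R)%:E <= phi x)%E /\ (phi x < (expR (k%:~R + 1))%:E)%E].

Let level_measurable k : measurable (level k : set (completion_type nu)).
Proof.
rewrite (_ : level k = setT `&` phi @^-1` `[(expR k%:~R)%:E, (expR (k%:~R + 1))%:E[ ).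
  by apply: mphi => //; exact: emeasurable_itv.
apply/seteqP; split=> x; rewrite /level/= in_itv/=; first by move=> [-> ->].
by move=> [_ /andP[]].
Qed.

Let level_cover x : (0 < phi x)%E -> (phi x < +oo)%E -> exists k, level k x.
Proof.
rewrite /level; case phix : (phi x) => [r| |]//; rewrite lte_fin => r0 _.
exists (Num.floor (ln r)); rewrite /= phix lee_fin lte_fin.
have /andP[] := floor_itv (ln r); rewrite intrD -(ler_expR (_%:~R)) -(ltr_expR (ln r)).
by rewrite lnK.
Qed.

Let level_fin k : (completion nu (level k) < +oo)%E.
Proof.
have : ((expR k%:~R)%:E * completion nu (level k) < +oo)%E.
  apply: le_lt_trans phi_fin.
  apply: (@le_trans _ _ (\int[completion nu]_(x in level k) cst (expR k%:~R)%:E x)%E).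
    by rewrite integral_cst.
  apply: (@le_trans _ _ (\int[completion nu]_(x in level k) phi x)%E).
    apply: ge0_le_integral => //; first by move=> x _; rewrite lee_fin expR_ge0.
      exact: measurable_funS mphi.
    by move=> x [].
  exact: ge0_subset_integral.
have := measure_ge0 (completion nu) (level k).
case: (completion nu (level k)) => [r _ _| _|//]; first exact: ltry.
by rewrite gt0_muley// lte_fin expR_gt0.
Qed.

(** Each shell is exhausted by compact pieces. [beta] is the upper end of the shell, so that [g x]
    lies in [beta *: D]; the factor [expR (-1)] is the ratio of the two ends. *)
Lemma layered_exhaustion : exists (K : nat -> set X) (beta : nat -> R),
  (forall j, [/\ carrier_piece (K j), 0 < beta j,
    forall x, K j x -> ((expR (-1) * beta j)%:E <= phi x)%E &
    forall x, K j x -> exists2 v, D v & g x = beta j *: v]) /\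
  nu.-negligible [set x | g x != 0 /\ forall j, ~ K j x].
Proof.
have /choice[A AP] : forall k, exists A : set X, exists N : set X,
    [/\ measurable (A : set (borel_type X)), nu.-negligible N,
    level k = A `|` N & completion nu (level k) = nu A].
  by move=> k; have [A [N H]] := completion_measurable_ex (level_measurable k); exists A, N.
have /choice[N ANP] := AP.
have /choice[K KP] : forall k, exists K : nat -> set X,
    (forall i, carrier_piece (K i) /\ K i `<=` A k) /\
    nu.-negligible (A k `\` \bigcup_i K i).
  move=> k; have [mA nN lE nuE] := ANP k.
  by apply: (carrier_exhaustion mA); rewrite -nuE level_fin.
(* Indices coding no pair repeat the piece of [(0, 0)], so that every index has a valid piece. *)
pose p j : int * nat := odflt (0, 0%N) (unpickle j).
exists (fun j => K (p j).1 (p j).2), (fun j => expR ((p j).1%:~R + 1)); split=> [j|].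
  have [Kp KA] := (KP (p j).1).1 (p j).2.
  have Kl x : K (p j).1 (p j).2 x -> level (p j).1 x.
    by move=> /KA Ax; have [_ _ -> _] := ANP (p j).1; left.
  split; [exact: Kp|exact: expR_gt0| |].
    by move=> x /Kl[+ _]; rewrite -expRD [-1 + _]addrC addrK.
  by move=> x /Kl[_ /(gauge_lt aD)].
have phi_infty : nu.-negligible [set x | phi x = +oo%E].
  have iphi : (completion nu).-integrable setT phi.
    apply/integrableP; split=> //; under eq_integral do rewrite gee0_abs//.
    exact: phi_fin.
  have [B [mB B0 Binf]] := integrable_ae measurableT iphi.
  apply: negligibleS (completion_null mB B0) => x phix; apply: Binf => /= /(_ I).
  by rewrite phix.
pose q j : int := odflt 0 (unpickle j).
have nZ : nu.-negligible ([set x | phi x = +oo%E] `|`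
    \bigcup_j (N (q j) `|` (A (q j) `\` \bigcup_i K (q j) i))).
  apply: negligibleU => //; apply: negligible_bigcup => j.
  by apply: negligibleU; [have [] := ANP (q j)|exact: (KP _).2].
apply: negligibleS nZ => x [gx0 nK].
have [phix|phix] := eqVneq (phi x) +oo%E; [by left|right].
have phi0 : (0 < phi x)%E.
  rewrite lt0e phi_ge0 andbT; apply/eqP => /(gauge_eq0 hE aD bD) gx.
  by rewrite gx eqxx in gx0.
have [|k kx] := level_cover phi0; first by rewrite ltey.
exists (pickle k) => //; rewrite /q pickleK/=.
have [_ _ lE _] := ANP k; move: kx; rewrite lE => -[Ax|]; [right|by left].
split=> // -[i _ Kx]; apply: (nK (pickle (k, i))).
by rewrite /p pickleK.
Qed.

End exhaustion.

(** * Integration over a sequence of compact pieces *)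

Section forward.
Context (R : realType) (E : tvsType R) (X : ptopologicalType).
Context (nu : {measure set (borel_type X) -> \bar R}) (g : X -> E).
Variable K : nat -> set X.
Hypothesis KP : forall j, carrier_piece g (K j).
Hypothesis K_cover : nu.-negligible [set x | g x != 0 /\ forall j, ~ K j x].

Let mK j : measurable (K j : set (borel_type X)). Proof. by have [] := KP j. Qed.

Let mG j : measurable (seqDU K j : set (borel_type X)).
Proof. by apply: seqDU_measurable => i; exact: mK. Qed.

Lemma piece_measurable j (h : E -> R) : continuous h ->
  measurable_fun (K j : set (borel_type X)) (fun x => h (g x)).
Proof.
move=> ch; apply: (measurability _ (RGenOpens.measurableE R)).
move=> _ [_ [a [b ->] <-]]; have [_ _ _ gK] := KP j.
have hgK : {within K j, continuous (h \o g)}.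
  by move=> x A hA; exact: (gK x (h @^-1` A) (ch (g x) A hA)).
have oab : open (`]a, b[%classic : set R) by exact: interval_open.
move/continuousP : hgK => /(_ _ oab).
move=> /open_subspaceP[V oV VK].
rewrite setIC -[X in measurable X]/((h \o g) @^-1` `]a, b[ `&` K j) -VK.
by apply: measurableI => //; exact: sub_sigma_algebra.
Qed.

(** Off the pieces [h] vanishes at [g x] for almost all [x]. There the preimage of [Y] is therefore
    negligible if [Y] omits 0, and has negligible complement if [Y] contains 0. *)
Lemma scalar_measurable (h : E -> R) : continuous h -> h 0 = 0 ->
  measurable_fun (setT : set (completion_type nu)) (fun x => h (g x)).
Proof.
move=> ch h0 _ Y mY; rewrite setTI; set S := _ @^-1` Y.
rewrite -[S]setIT -(setUv (\bigcup_j K j)) setIUr setI_bigcupr.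
apply: measurableU.
  apply: bigcupT_measurable => j; apply: completion_measurable.
  by rewrite setIC; exact: piece_measurable.
have mC : measurable (~` \bigcup_j K j : set (completion_type nu)).
  by apply: measurableC; apply: bigcupT_measurable => j; exact: completion_measurable.
have small (Z : set X) : (forall x, Z x -> h (g x) != 0 /\ ~ (\bigcup_j K j) x) ->
    measurable (Z : set (completion_type nu)).
  move=> hZ; apply: completion_negligible; apply: negligibleS K_cover => x /hZ[hx nx].
  split; last by move=> j Kx; apply: nx; exists j.
  by apply: contra_neq hx => ->.
have [Y0|Y0] := pselect (Y 0); last first.
  apply: small => x [Sx nx]; split=> //; apply/eqP => hx.
  by apply: Y0; rewrite -hx.
rewrite setIC (_ : _ `&` S = (~` \bigcup_j K j) `\` ((~` \bigcup_j K j) `&` ~` S)).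
  apply: measurableD => //; apply: small => x [nx nSx]; split=> //; apply/eqP => hx.
  by apply: nSx; rewrite /S/= hx.
apply/seteqP; split=> x [nx Sx]; split=> //; first by case.
by apply: contrapT => nSx; apply: Sx.
Qed.

(** Markov's inequality on each piece after disjointization, which makes the integrals of [phi] over
    the pieces add up to at most the whole integral. *)
Lemma pieces_summable (phi : X -> \bar R) (beta : nat -> R) (c : R) : 0 < c ->
  measurable_fun (setT : set (completion_type nu)) phi -> (forall x, 0 <= phi x)%E ->
  (\int[completion nu]_x phi x < +oo)%E -> (forall j, 0 < beta j) ->
  (forall j x, K j x -> ((c * beta j)%:E <= phi x)%E) ->
  (forall j, nu (seqDU K j) \is a fin_num)%E /\
  exists M, forall n, \sum_(j < n) beta j * fine (nu (seqDU K j)) <= M.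
Proof.
move=> c0 mphi phi0 phi_fin b0 Kphi.
have mGc j : measurable (seqDU K j : set (completion_type nu)).
  exact: completion_measurable.
pose I j := (\int[completion nu]_(x in seqDU K j) phi x)%E.
have I0 j : (0 <= I j)%E by apply: integral_ge0.
have GI j : ((c * beta j)%:E * nu (seqDU K j) <= I j)%E.
  apply: (@le_trans _ _ (\int[completion nu]_(x in seqDU K j) cst (c * beta j)%:E x)%E).
    by rewrite completion_integral_cst.
  apply: ge0_le_integral => //; first by move=> x _; rewrite lee_fin mulr_ge0 ?ltW.
    exact: measurable_funS mphi.
  by move=> x Gx; apply: Kphi; exact: subset_seqDU Gx.
have sumI n : (\sum_(0 <= j < n) I j <= \int[completion nu]_x phi x)%E.
  apply: (@le_trans _ _ (\sum_(0 <= j <oo) I j)%E).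
    by apply: nneseries_lim_ge.
  rewrite /I -ge0_integral_bigcup//.
  - by apply: ge0_subset_integral => //; exact: bigcupT_measurable.
  - exact: measurable_funS mphi.
have fin j : nu (seqDU K j) \is a fin_num.
  rewrite ge0_fin_numE// ltey; apply/eqP => nuoo.
  have Iphi : (I j <= \int[completion nu]_x phi x)%E by apply: ge0_subset_integral.
  have := le_lt_trans (le_trans (GI j) Iphi) phi_fin.
  by rewrite nuoo gt0_muley// lte_fin mulr_gt0.
split=> //; exists (c^-1 * fine (\int[completion nu]_x phi x)) => n.
rewrite ler_pdivlMl// mulr_sumr.
have phi_fn : (\int[completion nu]_x phi x)%E \is a fin_num.
  by rewrite ge0_fin_numE//; exact: integral_ge0.
rewrite -lee_fin fineK// -sumEFin; apply: le_trans (sumI n); rewrite big_mkord.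
apply: lee_sum => j _; rewrite mulrA EFinM fineK//.
Qed.

(** As [h] vanishes where [g] does, only the pieces contribute. This serves for the absolute value
    and for the negative part of [f \o g]. *)
Lemma pieces_integral_le (w : nat -> R) (M a : R) (h : X -> \bar R) :
  (forall j, nu (seqDU K j) \is a fin_num)%E -> (forall j, 0 <= w j) -> 0 <= a ->
  (forall n, \sum_(j < n) w j * fine (nu (seqDU K j)) <= M) ->
  measurable_fun (setT : set (completion_type nu)) h -> (forall x, 0 <= h x)%E ->
  (forall x, g x = 0 -> h x = 0%E) ->
  (forall j x, K j x -> (h x <= (a * w j)%:E)%E) ->
  (\int[completion nu]_x h x <= (a * M)%:E)%E.
Proof.
move=> fin w0 a0 wM mh h0 hg Kh.
have mGc j : measurable (seqDU K j : set (completion_type nu)).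
  exact: completion_measurable.
have mUG : measurable (\bigcup_j seqDU K j : set (completion_type nu)).
  exact: bigcupT_measurable.
have -> : (\int[completion nu]_x h x = \int[completion nu]_(x in \bigcup_j seqDU K j) h x)%E.
  rewrite [RHS]integral_mkcond; apply: ge0_ae_eq_integral => //.
  - by apply/(measurable_restrictT _ _).1 => //; exact: measurable_funS mh.
  - by move=> x _; exact: erestrict_ge0.
  - exists [set x | g x != 0 /\ forall j, ~ K j x]; split.
    + exact: completion_negligible.
    + exact: completion_eq0.
    + move=> x /= /not_implyP[_]; rewrite /patch; case: ifPn => //.
      rewrite notin_setE -seqDU_bigcup_eq => nx hx; split.
        by apply/eqP => /hg.
      by move=> j Kx; apply: nx; exists j.
rewrite ge0_integral_bigcup//; last exact: measurable_funS mh.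
apply: (@le_trans _ _ (\sum_(0 <= j <oo) (a * (w j * fine (nu (seqDU K j))))%:E)%E).
  apply: lee_nneseries => [j _ _|j _]; first exact: integral_ge0.
  apply: (@le_trans _ _ (\int[completion nu]_(x in seqDU K j) cst (a * w j)%:E x)%E).
    apply: ge0_le_integral => //; first exact: measurable_funS mh.
    by move=> x Gx; apply: Kh; exact: subset_seqDU Gx.
  by rewrite completion_integral_cst// mulrA [leRHS]EFinM fineK.
apply: lime_le.
  by apply: is_cvg_nneseries => j _ _; rewrite lee_fin !mulr_ge0// fine_ge0.
apply: nearW => n; rewrite sumEFin lee_fin -mulr_sumr big_mkord.
exact: ler_wpM2l.
Qed.

End forward.

Lemma mcc_pettis (R : realType) (E : tvsType R) (X : ptopologicalType)
    (nu : {measure set (borel_type X) -> \bar R}) (D : set E) (g : X -> E) :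
  hausdorff_space E -> metric_convex_compactness E ->
  metrically_regular nu -> lusin_measurable nu g ->
  tvs_bounded D -> absolutely_convex D ->
  measurable_fun (setT : set (completion_type nu)) (fun x => gauge_functional D (g x)) ->
  (\int[completion nu]_x gauge_functional D (g x) < +oo)%E ->
  pettis_integrable nu g.
Proof.
move=> hE mccE rnu lg bD aD mphi phi_fin.
have [K [beta [KP K_cover]]] := layered_exhaustion rnu lg hE bD aD mphi phi_fin.
have Kp j : carrier_piece g (K j) by have [] := KP j.
have b0 j : 0 < beta j by have [] := KP j.
have [fin [M1 M1P]] := pieces_summable Kp (expR_gt0 (-1)) mphi
  (fun x => gauge_ge0 D (g x)) phi_fin b0 (fun j => let: And4 _ _ h _ := KP j in h).
have c0 j : 0 <= beta j * fine (nu (seqDU K j)) by rewrite mulr_ge0 ?fine_ge0// ltW.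
have [eps [eps0 eps_cvg [M2 M2P]]] := slowly_vanishing_weights c0 M1P.
(* On [K j] the values of [g] lie in [beta j *: D], so multiplication by [(w j)^-1] brings them into
   [eps j *: D], which shrinks to 0. The compensating weights [w j] still have a bounded sum against
   the masses. *)
pose w j := beta j / eps j.
have w0 j : 0 < w j by rewrite divr_gt0.
have wM n : \sum_(j < n) w j * fine (nu (seqDU K j)) <= M2.
  apply: le_trans (M2P n); rewrite le_eqVlt; apply/orP; left; apply/eqP.
  by apply: eq_bigr => j _; rewrite mulrAC.
have M20 : 0 <= M2 by have := wM 0%N; rewrite big_ord0.
pose L j : set E := [set (w j)^-1 *: g x | x in K j].
pose S : set E := 0 |` \bigcup_j L j.
have cS : compact S.
  apply: compact_null_union => [j|U U0].
    have [_ cK _ gK] := Kp j.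
    apply: (@continuous_compact _ _ (fun x => (w j)^-1 *: g x)) => // x A hA.
    exact: (gK x _ (nbhs_scale hA)).
  have [r r0 rU] := bounded_scale_nbhs0 bD U0.
  have [N NP] := eps_cvg r r0; exists N => n Nn _ [x Kx <-].
  have [_ _ _ /(_ x Kx)[v Dv ->]] := KP n.
  rewrite scalerA /w invf_div divfK ?gt_eqF//.
  by apply: rU => //; exact: NP.
have mS : metrizable R S.
  have /choice[N NP] : forall j, exists N : nat * nat -> set E, network (L j) N.
    by move=> j; have [_ cK mK gK] := Kp j; exact: network_image.
  (* The extra index [None] takes care of the point 0. *)
  pose N' (i : option (nat * (nat * nat))) := if i is Some k then N k.1 k.2 else [set 0].
  apply: (@network_metrizable R E _ S N' hE cS) => x A [->|[j _ Lx]] xA.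
    by exists None; split=> // _ ->; exact: nbhs_singleton.
  by have [i [Nx NA]] := NP j x A Lx xA; exists (Some (j, i)).
have cC := mccE S cS mS; pose C := closed_convex_hull S.
have SC : S `<=` C by exact: sub_smallest.
have vC : convex_set C.
  apply/convex_setP => x y t t0 t1 Cx Cy A [[clA cvA] SA].
  by move/convex_setP : (cvA); apply=> //; [apply: Cx|apply: Cy].
have C0 : C 0 by apply: SC; left.
have w1 j x : K j x -> C ((w j)^-1 *: g x).
  by move=> Kx; apply: SC; right; exists j => //; exists x.
have fg j x (f : {linear E -> R^o}) : f (g x) = w j * f ((w j)^-1 *: g x) :> R.
  by rewrite functionalZ mulrA divff ?gt_eqF// mul1r.
pose I (h : E -> R) := (\int[completion nu]_x (h (g x))%:E)%E.
have mf (f : {linear E -> R^o}) : continuous f ->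
    measurable_fun (setT : set (completion_type nu)) (fun x => (f (g x))%:E).
  move=> cf; have /measurable_EFinP : measurable_fun (setT : set (completion_type nu))
      (fun x => (f (g x) : R)).
    by apply: (scalar_measurable Kp K_cover cf); exact: linear0.
  exact.
have If (f : {linear E -> R^o}) : continuous f ->
    (completion nu).-integrable setT (fun x => (f (g x))%:E).
  move=> cf; apply/integrableP; split; first exact: mf.
  have [B [Breal BC]] : bounded_set (f @` C : set R^o).
    by apply: compact_bounded; apply: continuous_compact => //; exact: continuous_subspaceT.
  have {}BC v : C v -> `|f v : R| <= `|B| + 1.
    move=> Cv; apply: (BC (`|B| + 1)); last by exists v.
    by rewrite (le_lt_trans (ler_norm _))// ltrDl.
  apply: (@le_lt_trans _ _ ((`|B| + 1) * M2)%:E); last exact: ltry.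
  apply: (pieces_integral_le Kp K_cover fin (fun j => ltW (w0 j)) _ wM) => //.
  - exact: (measurableT_comp _ (mf f cf)).
  - by move=> x gx; rewrite gx linear0 abse0.
  - move=> j x Kx; rewrite lee_fin (fg j) normrM (gtr0_norm (w0 j)) mulrC.
    by rewrite ler_pM2r//; apply: BC; exact: w1.
(* The weights [w j * nu (seqDU K j)] have total at most [M2]. With the missing mass placed at the
   point 0 of [C], division by [M2 + 1] makes [J] a mean over [C]; the added 1 keeps the divisor
   positive. *)
pose J h := fine (I h) / (M2 + 1).
have M21 : 0 < M2 + 1 by lra.
have IJ (f : {linear E -> R^o}) : continuous f -> I f = (fine (I f))%:E.
  by move=> cf; rewrite fineK//; exact: integrable_fin_num (If f cf).
have J_lin (a : R) (f h : {linear E -> R^o}) : continuous f -> continuous h ->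
    J (fun x => a * f x + h x) = a * J f + J h.
  move=> cf ch; rewrite /J mulrA -mulrDl; congr (_ / _).
  rewrite /I; under eq_integral do rewrite EFinD EFinM.
  rewrite integralD//; [|by apply: integrableZl => //; exact: If|exact: If].
  rewrite integralZl//; last exact: If.
  by rewrite -!/(I _) (IJ f cf) (IJ h ch).
have J_ge (f : {linear E -> R^o}) (m : R) : continuous f ->
    (forall x, C x -> m <= f x) -> m <= J f.
  (* Since [m <= 0], it is enough to bound the integral of the negative part of [f \o g] by
     [- m * M2]. *)
  move=> cf Cm; have m0 : m <= 0 by have := Cm 0 C0; rewrite linear0.
  rewrite /J ler_pdivlMr//; apply: (@le_trans _ _ (m * M2)); first nra.
  rewrite -lee_fin -IJ// /I integralE; set F := fun x => (f (g x))%:E.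
  have Fneg : (\int[completion nu]_x F^\- x <= (- m * M2)%:E)%E.
    apply: (pieces_integral_le Kp K_cover fin (fun j => ltW (w0 j)) _ wM) => //.
    - by rewrite oppr_ge0.
    - exact: (measurable_funeneg (mf f cf)).
    - by move=> x gx; rewrite /F funenegE gx linear0 oppe0 maxxx.
    - move=> j x Kx; rewrite funenegE /F (fg j) -EFinN ge_max !lee_fin.
      rewrite mulr_ge0 ?oppr_ge0// ?(ltW (w0 j))// andbT -mulrN mulrC ler_pM2r// lerN2.
      by apply: Cm; exact: w1.
  have Fpos : (0 <= \int[completion nu]_x F^\+ x)%E by apply: integral_ge0.
  rewrite mulNr EFinN in Fneg; rewrite -[leLHS]add0e -[X in (0 + X)%E]oppeK.
  apply: leeB => //.
have [|c Cc cJ] := barycenter J_lin J_ge cC vC; first by exists 0.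
split=> //; exists ((M2 + 1) *: c) => f cf.
by rewrite -/(I f) IJ// functionalZ cJ// /J mulrC divfK// gt_eqF.
Qed.

(** * Measures on the Cantor space *)

Section cantor_parametrization.

Lemma prod_cvg (I : Type) (T : I -> topologicalType)
    (F : set_system (prod_topology T)) (a : prod_topology T) : Filter F ->
  (forall i, (fun f : prod_topology T => f i) @ F --> a i) -> F --> a.
Proof.
move=> FF h; apply/cvg_sup => i A; rewrite (@nbhsE (initial_topology _)) => -[B [[V oV VB] Ba] BA].
apply: filterS BA _; rewrite -VB; apply: h.
by apply: open_nbhs_nbhs; split=> //; move: Ba; rewrite -VB.
Qed.

Lemma cantor_cylinder_nbhs (a : cantor_space) N :
  nbhs a [set b : cantor_space | forall i, (i < N)%N -> b i = a i].
Proof.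
elim: N => [|N IH]; first by apply: (@filterS _ (nbhs a) _ setT) => //; exact: filterT.
have aN : nbhs a [set b : cantor_space | b N = a N].
  have := @proj_continuous _ (fun _ : nat => bool) N a [set a N].
  by apply; rewrite (@nbhs_principalE bool).
apply: filterS2 IH aN => b IH aN i; rewrite ltnS leq_eqVlt => /predU1P[->//|].
exact: IH.
Qed.

Lemma cantor_cylinder_sub (a : cantor_space) A : nbhs a A ->
  exists N, forall b : cantor_space, (forall i, (i < N)%N -> b i = a i) -> A b.
Proof.
pose F : set_system cantor_space := filter_from setT
  (fun N => [set b : cantor_space | forall i, (i < N)%N -> b i = a i]).
have FF : Filter F.
  apply: filter_from_filter; first by exists 0%N.
  move=> N M _ _; exists (N + M)%N => // b h; split=> i iN; apply: h.
    exact: ltn_addr.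
  exact: ltn_addl.
have Fa : F --> a.
  apply: prod_cvg => i V Va; exists i.+1 => // b /(_ i (ltnSn i)) /= ->.
  exact: nbhs_singleton.
by move=> /Fa[N _ NA]; exists N.
Qed.

(** Uniform continuity. Near each point a cylinder of some length works, and compactness in its
    near-covering form gives one length for all points. *)
Lemma cantor_uniform (R : realType) (E : tvsType R) (h : cantor_space -> E) (U : set E) :
  continuous h -> nbhs 0 U ->
  exists N, forall a b : cantor_space, (forall i, (i < N)%N -> a i = b i) -> U (h a - h b).
Proof.
move=> ch U0; have [W W0 WU] := nbhs0_half U0.
have NW0 : nbhs 0 [set v | W (- v)].
  by have := nbhs0N W0; apply: filterS => _ [v Wv <-]; rewrite /= opprK.
have /compact_near_coveringP/(_ _ \oo%classic (fun n a => forall b : cantor_space,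
    (forall i, (i < n)%N -> a i = b i) -> U (h a - h b))) := cantor_space_compact.
case=> [a _|N _ NP]; last first.
  by exists N => a b; apply: (NP N) => //=.
have [N NP] := cantor_cylinder_sub (ch a _ (nbhs_translate (h a) (filterI W0 NW0))).
exists ([set b : cantor_space | forall i, (i < N)%N -> b i = a i], [set n | (N <= n)%N]).
  by split; [exact: cantor_cylinder_nbhs|exists N].
move=> [a' n] /= [a'a Nn] b a'b.
have [Wa' _] := NP a' a'a.
have [|_ Wb] := NP b; first by move=> i iN; rewrite -a'b ?a'a//; exact: leq_trans Nn.
rewrite (_ : h a' - h b = (h a' - h a) + - (h b - h a)); first exact: WU.
by rewrite opprB addrA subrK.
Qed.

(** As [d] is a metric on [K] only, [K] is first turned into a pointed metric space of its own,
    which the Cantor space covers; [iota] then maps it continuously back into [E]. *)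
Lemma cantor_onto (R : realType) (E : topologicalType) (K : set E) :
  K !=set0 -> compact K -> metrizable R K ->
  exists h : cantor_space -> E, continuous h /\ range h = K.
Proof.
move=> [x0 Kx0] cK [d [d_ge0 d_eq0 dC dD dn]].
pose M := {x : E | K x}.
pose C : choiceType := HB.pack M (gen_eqMixin M) (gen_choiceMixin M).
pose dM (x y : C) : R := d (sval x) (sval y).
have dxx (x : C) : dM x x = 0 by apply/(d_eq0 _ _ (svalP x) (svalP x)).
have dpos (x y : C) : dM x y = 0 -> x = y.
  case: x y => [x Kx] [y Ky] /(d_eq0 _ _ Kx Ky) /= xy.
  exact: eq_exist.
have dsym (x y : C) : dM x y = dM y x by exact: dC (svalP x) (svalP y).
have dtri (y x z : C) : dM x z <= dM x y + dM y z.
  exact: dD (svalP x) (svalP y) (svalP z).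
pose T : metricType R := HB.pack (Choice.sort C) (isMetric.Build R C dxx dpos dsym dtri).
pose pT : pseudoPMetricType R := HB.pack (T : Type) (Metric.on T)
  (isPointed.Build (T : Type) (exist _ x0 Kx0 : M)).
pose iota (x : pT) : E := sval (x : M).
have iotaK (x : pT) : K (iota x) by exact: svalP (x : M).
have ballE (x y : pT) (e : R) : ball x e y <-> d (iota x) (iota y) < e.
  by rewrite -[ball x e]/(@ball R T x e) ballEmdist.
have ciota : continuous iota.
  move=> x A xA; have : within K (nbhs (iota x)) A by move: xA; apply: filterS.
  move=> /(dn _ (iotaK x))[e e0 eA]; apply/nbhs_ballP; exists e => // y /ballE.
  exact/eA/iotaK.
have cT : compact [set: pT].
  move=> F FF _; have FK : F (iota @^-1` K) by apply: filterS filterT => y _; exact: iotaK.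
  have [z [Kz Fz]] := cK _ (fmap_proper_filter iota FF) FK.
  exists (exist _ z Kz); split=> // A B FA /nbhs_ballP[e /= e0 eB].
  have FiA : F (iota @^-1` (iota @` A)) by apply: filterS FA => y Ay; exists y.
  have ze : nbhs z [set y | K y -> d z y < e] by apply/(dn z Kz); exists e.
  have [_ [[y Ay <-] zy]] := Fz _ _ FiA ze.
  by exists y; split=> //; apply: eB; apply/ballE; apply: zy; exact: iotaK.
have hT : hausdorff_space pT by exact: (@metric_hausdorff R T).
have [f cf] := cantor_surj cT hT.
exists (iota \o f); split.
  by move=> a; apply: continuous_comp; [exact: cf|exact: ciota].
apply/seteqP; split=> [_ [a _ <-]|x Kx]; first exact: iotaK.
have [|a _ fa] := @surj _ _ _ _ f (exist _ x Kx : pT); first by [].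
by exists a => //=; rewrite fa.
Qed.

End cantor_parametrization.

(* Words are read from the last bit to the first one: [b :: s] is the word [s]
   followed by the bit [b]. *)
Section binary_splitting.
Context (R : realType).
Implicit Types (w : seq bool -> R) (s : seq bool) (t : R) (n : nat).

(** Masses of cylinders: the encoding of a Borel probability measure on the Cantor space. *)
Definition mass_system : set (seq bool -> R) := [set w |
  [/\ w [::] = 1, forall s, 0 <= w s & forall s, w s = w (false :: s) + w (true :: s)]].

(** The two children of a cell are laid side by side, [false] on the left. For a mass system the
    cells of a given level tile [[0, 1[], and words of mass 0 have empty cells. *)
Fixpoint left_end w s : R :=
  if s is b :: s' then left_end w s' + (if b then w (false :: s') else 0) else 0.

Definition cell w s : set R := `[left_end w s, left_end w s + w s[%classic.

Definition cut w s : R := left_end w s + w (false :: s).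

(** The first [n] bits of the address of [t]. The resulting [branch w] is a quantile map for the
    lexicographic order: it carries Lebesgue measure on [[0, 1[] to the measure encoded by [w]. *)
Fixpoint branch_word w t n : seq bool :=
  if n is m.+1 then
    let s := branch_word w t m in (cut w s <= t) :: s
  else [::].

Definition branch w t : cantor_space := fun n => cut w (branch_word w t n) <= t.

Definition word_point s : cantor_space := fun i => nth false (rev s) i.

Lemma size_branch_word w t n : size (branch_word w t n) = n.
Proof. by elim: n => //= n ->. Qed.

Lemma branch_word_point w t n i : (i < n)%N ->
  branch w t i = word_point (branch_word w t n) i.
Proof.
elim: n => // n IH; rewrite /word_point /= rev_cons nth_rcons size_rev size_branch_word.
rewrite ltnS leq_eqVlt => /predU1P[->|ni]; first by rewrite ltnn eqxx.
by rewrite ni IH.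
Qed.

Lemma cell_split w s : mass_system w ->
  cell w s = cell w (false :: s) `|` cell w (true :: s).
Proof.
move=> [_ w0 wD]; rewrite /cell/= addr0 {1}wD.
have w0s := w0 (false :: s); have w1s := w0 (true :: s).
apply/seteqP; split=> t /=; rewrite !in_itv/=.
  case/andP=> st ts; have [tc|ct] := ltP t (left_end w s + w (false :: s)).
    by left; rewrite st.
  by right; lra.
by case=> /andP[]; lra.
Qed.

Lemma cell_disjoint w s : [disjoint cell w (false :: s) & cell w (true :: s)].
Proof.
rewrite /cell/= addr0; apply/disj_setPS => t [] /=; rewrite !in_itv/=.
by move=> /andP[_ tc] /andP[ct _]; move: (lt_le_trans tc ct); rewrite ltxx.
Qed.

Lemma branch_word_cell w t s : mass_system w -> cell w s t ->
  branch_word w t (size s) = s.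
Proof.
move=> wP; elim: s => [//|b s IH] bst.
have st : cell w s t by rewrite cell_split//; case: b bst; [right|left].
rewrite /= IH//; congr (_ :: _); rewrite /cut; move: bst.
rewrite /cell/= in_itv/=; case: b => /andP[].
  by [].
by rewrite addr0 => _ tc; rewrite leNgt tc.
Qed.

Definition cuts w : set R := range (cut w).

Lemma cuts_countable w : countable (cuts w).
Proof.
exact: sub_countable (card_image_le _ _) (countableP _).
Qed.

(** Each bit results from finitely many comparisons with cuts, and a comparison of [t] with a cut
    other than [t] is locally constant. *)
Lemma branch_continuous w t : ~ cuts w t -> {for t, continuous (branch w)}.
Proof.
move=> nt; have near_word n : \forall u \near t, branch_word w u n = branch_word w t n.
  elim: n => [|n IH]; first exact: (@filterE _ (nbhs t)).
  set c := cut w (branch_word w t n).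
  have ct : c != t by apply/eqP => ct; apply: nt; exists (branch_word w t n).
  have near_c : \forall u \near t, (c <= u) = (c <= t).
    have [|tc] := leP c t.
      rewrite le_eqVlt (negPf ct)/= => {}ct.
      have := lt_nbhsr ct; apply: filterS => u /ltW; exact.
    by have := lt_nbhsl tc; apply: filterS => u ut; rewrite leNgt ut.
  by apply: filterS2 IH near_c => u /= -> ->.
apply: prod_cvg => i A /nbhs_singleton Ai.
suff : \forall u \near t, A (branch w u i) by [].
by apply: filterS (near_word i.+1) => u /= [uE _]; rewrite /branch uE.
Qed.

Section weighted_points.
Context (E : tvsType R) (x : seq bool -> E).

(** A Riemann sum: the sum of the [w z *: x z] over the words [z] extending [s] by [n] bits. *)
Fixpoint cell_sum w n s : E :=
  if n is m.+1 then cell_sum w m (false :: s) + cell_sum w m (true :: s)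
  else w s *: x s.

Lemma cell_sum_conv w v (a b : R) n s :
  cell_sum (fun s => a * w s + b * v s) n s = a *: cell_sum w n s + b *: cell_sum v n s.
Proof.
elim: n s => [|n IH] s /=; first by rewrite scalerDl !scalerA.
by rewrite !IH !scalerDr addrACA.
Qed.

Lemma cell_sum_continuous (W : topologicalType) (u : W -> seq bool -> R) n s :
  (forall s, continuous (fun a => u a s)) -> continuous (fun a => cell_sum (u a) n s).
Proof.
move=> cu; elim: n s => [|n IH] s a /= A aA.
  have [[B1 B2] /= [B1a B2x] BA] := @scale_continuous R E (u a s, x s) A aA.
  have B2xs := nbhs_singleton B2x.
  have Ba : nbhs a [set b | B1 (u b s)] by exact: (cu s a B1 B1a).
  suff : nbhs a [set b | A (u b s *: x s)] by [].
  by apply: filterS Ba => b B1b; exact: (BA (u b s, x s)).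
have [[B1 B2] /= [B1a B2a] BA] := @add_continuous E (_, _) A aA.
have B1b : nbhs a [set b | B1 (cell_sum (u b) n (false :: s))] by exact: (IH _ a B1 B1a).
have B2b : nbhs a [set b | B2 (cell_sum (u b) n (true :: s))] by exact: (IH _ a B2 B2a).
suff : nbhs a [set b | A (cell_sum (u b) n (false :: s) + cell_sum (u b) n (true :: s))] by [].
by apply: filterS2 B1b B2b => b bB1 bB2; exact: (BA (_, _)).
Qed.

End weighted_points.

Lemma mass_system_le1 w s : mass_system w -> w s <= 1.
Proof.
move=> [w1 w0 wD]; elim: s => [|b s IH]; first by rewrite w1.
apply: le_trans IH; rewrite (wD s).
have := w0 (false :: s); have := w0 (true :: s).
by case: b; lra.
Qed.

Lemma mass_system_closed (W : topologicalType) (u : W -> seq bool -> R) :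
  (forall s, continuous (fun a => u a s)) -> closed [set a | mass_system (u a)].
Proof.
move=> cu; rewrite (_ : [set a | _] = [set a | u a [::] = 1] `&`
   ((\bigcap_s [set a | 0 <= u a s]) `&`
   (\bigcap_s [set a | u a s - (u a (false :: s) + u a (true :: s)) = 0]))); last first.
  apply/seteqP; split=> a.
    case=> w1 w0 wD; split=> //; split=> s _ /=; first exact: w0.
    by rewrite wD subrr.
  case=> w1 [w0 wD]; split=> // s; first exact: w0.
  by apply/eqP; rewrite -subr_eq0; apply/eqP; exact: wD.
have closed_preimage (f : W -> R) (C : set R) : continuous f -> closed C -> closed (f @^-1` C).
  by move=> cf cC; apply: closed_comp => // a _; exact: cf.
apply: closedI; first exact: (closed_preimage _ _ (cu [::]) (@closed_eq R 1)).
apply: closedI; apply: closed_bigI => s _.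
  exact: (closed_preimage _ _ (cu s) (@closed_ge R 0)).
apply: (closed_preimage (fun a => u a s - (u a (false :: s) + u a (true :: s))) _ _
  (@closed_eq R 0)).
move=> a; apply: (@cvgB _ R^o); first exact: cu.
by apply: (@cvgD _ R^o); exact: cu.
Qed.

(** With pointwise convergence the mass systems form a closed subset of a product of unit intervals,
    hence a compact set. *)
Definition mass_space : topologicalType := prod_topology (fun _ : seq bool => R).

Lemma mass_space_eval s : continuous (fun w : mass_space => (w : seq bool -> R) s).
Proof. exact: (@proj_continuous _ (fun _ : seq bool => R) s). Qed.

Lemma mass_system_compact : compact (mass_system : set mass_space).
Proof.
have cI : compact [set w : mass_space | forall s, `[0, 1]%classic ((w : seq bool -> R) s)].
  exact: (@tychonoff _ (fun _ : seq bool => R) (fun=> `[0, 1]%classic)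
    (fun=> @segment_compact R 0 1)).
apply: subclosed_compact cI _.
  exact: (@mass_system_closed mass_space (fun w => w : seq bool -> R) mass_space_eval).
move=> w wP s /=; rewrite in_itv/= mass_system_le1// andbT.
by have [_] := wP.
Qed.

End binary_splitting.

(** * Polar hulls of compact sets and semicontinuity of gauges *)

Section polar_hulls.
Context (R : realType) (E : tvsType R).
Implicit Types (K D : set E).

(** The absolute bipolar of [K]; it provides the set [D] in the integrability condition. *)
Definition polar_hull K : set E := [set x | forall f : {linear E -> R^o},
  continuous f -> (forall k, K k -> `|f k : R| <= 1) -> `|f x : R| <= 1].

Lemma sub_polar_hull K : K `<=` polar_hull K.
Proof. by move=> k Kk f _; exact. Qed.

Lemma polar_hull_closed K : closed (polar_hull K).
Proof.
rewrite (_ : polar_hull K = \bigcap_(f in [set f : {linear E -> R^o} |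
    continuous f /\ forall k, K k -> `|f k : R| <= 1])
    (fun x => `|f x : R|) @^-1` [set y : R | y <= 1]); last first.
  by apply/seteqP; split=> x h f; [case=> cf fK; exact: h|move=> cf fK; exact: (h f)].
apply: closed_bigI => f [cf _]; apply: closed_comp; last exact: closed_le.
by move=> x _; apply: cvg_norm; exact: cf.
Qed.

Lemma polar_hull_absolutely_convex K : K !=set0 -> absolutely_convex (polar_hull K).
Proof.
move=> [k Kk]; split; first by exists k; exact: sub_polar_hull.
  apply/convex_setP => x y t t0 t1 Kx Ky f cf fK.
  rewrite functionalD !functionalZ (le_trans (ler_normD _ _))// !normrM.
  have fx := Kx f cf fK; have fy := Ky f cf fK.
  rewrite (ger0_norm t0) (ger0_norm (_ : 0 <= 1 - t)) ?subr_ge0//; nra.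
move=> a x a1 Kx f cf fK; rewrite functionalZ normrM.
by rewrite -[leRHS]mulr1 ler_pM//; exact: Kx.
Qed.

Lemma compact_scale K V : compact K -> nbhs 0 V ->
  exists2 r : R, 0 < r & forall k, K k -> V (r^-1 *: k).
Proof.
move=> cK V0.
have /compact_near_coveringP/(_ _ \oo%classic (fun n k => V (n.+1%:R^-1 *: k))) := cK.
case=> [k Kk|N _ NV]; last by exists N.+1%:R => // k Kk; apply: (NV N) => //=.
have /= := @scale_continuous R E (0, k) V; rewrite scale0r => /(_ V0).
move=> [[B1 B2] /= [/nbhs_ballP[e /= e0 eB] B2k] BV].
have [N Ne] := invn_lt e0.
exists (B2, [set n | (N <= n)%N]); first by split=> //; exists N.
move=> [k' n] /= [B2k' Nn]; apply: (BV (n.+1%:R^-1, k')); split=> //=.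
by apply: eB; rewrite /ball /= sub0r normrN gtr0_norm ?invr_gt0// Ne.
Qed.

(** If [s^-1 *: x] were outside [V], some [f] bounded by 1 on [V] would be at least 1 there. As [f]
    is bounded by [r] on [K], it is bounded by [r] at [x] too, which is impossible for [|s| > r]. *)
Lemma polar_hull_bounded K : compact K -> tvs_bounded (polar_hull K).
Proof.
move=> cK U U0; have [V [V0 cV VU]] := nbhs0_convex U0.
have NV0 : nbhs 0 [set v | V (- v)].
  by have := nbhs0N V0; apply: filterS => _ [v Vv <-]; rewrite /= opprK.
have [r r0 rK] := compact_scale cK (filterI V0 NV0).
exists (r + 1); first by rewrite addr_gt0.
move=> s rs x Kx; have sr : r < `|s| by rewrite (lt_le_trans _ rs)// ltrDl.
have s_neq0 : s != 0 by rewrite -normr_gt0 (lt_trans r0).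
exists (s^-1 *: x); last by rewrite scalerA divff// scale1r.
apply: VU; apply: contrapT => /(convex_separation V0 cV)[f [cf fV fx]].
pose h : {linear E -> R^o} := r^-1 \*: f.
have ch : continuous h.
  by move=> y; apply: (@cvgM R); [exact: cvg_cst|exact: cf].
have : `|h x : R| <= 1.
  apply: (Kx h ch) => k Kk; have [/fV + /fV] := rK k Kk.
  by rewrite functionalN functionalZ ler_norml lerNl => -> ->.
rewrite /h/= normrM gtr0_norm ?invr_gt0// ler_pdivrMl// mulr1 => fr.
move: fx; rewrite functionalZ leNgt => /negP; apply.
apply: le_lt_trans (ler_norm _) _; rewrite normrM normfV ltr_pdivrMl ?normr_gt0//.
by rewrite mulr1 (le_lt_trans fr).
Qed.

(** Lower semicontinuity of the gauge: for [t] strictly between [c] and the gauge of [e], the point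
    [t^-1 *: e] lies in the open complement of [D]. *)
Lemma gauge_open D (c : R) : closed D -> absolutely_convex D ->
  open [set e | (c%:E < gauge_functional D e)%E].
Proof.
move=> cD aD; rewrite openE => e /= ce; have [c0|c0] := ltP c 0.
  by apply: filterE => v /=; rewrite (lt_le_trans _ (gauge_ge0 D v))// lte_fin.
have [t [t0 ct te]] : exists t, [/\ 0 < t, c < t & (t%:E < gauge_functional D e)%E].
  move: ce; case: (gauge_functional D e) => [r| |//]; rewrite ?lte_fin => ce.
    by exists ((c + r) / 2); rewrite lte_fin; split; lra.
  by exists (c + 1); split; [lra|lra|exact: ltry].
have nDe : (~` D) (t^-1 *: e).
  move=> De; move: te; rewrite ltNge => /negP; apply; apply: ereal_inf_lbound.
  exists t => //; split=> //; exists (t^-1 *: e) => //.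
  by rewrite scalerA divff ?gt_eqF// scale1r.
have : nbhs (t^-1 *: e) (~` D).
  by apply: open_nbhs_nbhs; split=> //; exact: closed_openC.
move=> /nbhs_scale; apply: filterS => v nDv /=.
rewrite (@lt_le_trans _ _ t%:E)// leNgt; apply/negP => /(gauge_lt aD)[d Dd vE].
by apply: nDv; rewrite vE scalerA mulVf ?gt_eqF// scale1r.
Qed.

End polar_hulls.

(** * Lebesgue measure on the unit interval *)

Section unit_interval_measure.
Context (R : realType).

Let I01 : set R := `[0, 1[%classic.

Lemma borel_type_lebesgue (A : set (borel_type R)) : measurable A ->
  measurable (A : set (measurableTypeR R)).
Proof.
move: A; apply: smallest_sub; first exact: sigma_algebra_measurable.
by move=> A; exact: open_measurable.
Qed.

Lemma borel_closed (A : set R) : closed A -> measurable (A : set (borel_type R)).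
Proof.
by move=> cA; rewrite -[A]setCK; apply: measurableC; apply: sub_sigma_algebra; exact: closed_openC.
Qed.

Lemma borel_itv_co (a b : R) : measurable (`[a, b[%classic : set (borel_type R)).
Proof.
rewrite (_ : `[a, b[%classic = `[a, +oo[%classic `\` `[b, +oo[%classic); last first.
  apply/seteqP; split=> x /=; rewrite !in_itv/= !andbT.
    by move=> /andP[-> xb]; split=> //; apply/negP; rewrite -ltNge.
  by move=> [-> /negP]; rewrite -ltNge.
by apply: measurableD; apply: borel_closed; exact: interval_closed.
Qed.

(** [borel_type R] and [measurableTypeR R] are distinct measurable structures on the line, so the
    restricted Lebesgue measure is transported along the inclusion of the first sigma-algebra in the
    second. *)
Lemma unit_interval_measure : exists nu : {measure set (borel_type R) -> \bar R},
  forall A, nu A = lebesgue_measure (A `&` I01 : set (measurableTypeR R)).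
Proof.
have mI : measurable (I01 : set (measurableTypeR R)) by exact: measurable_itv.
pose m := mrestr lebesgue_measure mI.
pose f : set (borel_type R) -> \bar R := m.
have f0 : f set0 = 0%E by rewrite /f /m /mrestr set0I measure0.
have f_ge0 A : (0 <= f A)%E by exact: measure_ge0.
have f_sigma : semi_sigma_additive f.
  move=> F mF tF mUF; apply: (@measure_semi_sigma_additive _ _ _ m) => //.
  - by move=> i; exact: borel_type_lebesgue.
  - exact: borel_type_lebesgue.
pose nu : {measure set (borel_type R) -> \bar R} :=
  HB.pack f (isMeasure.Build _ (borel_type R) R f f0 f_ge0 f_sigma).
by exists nu.
Qed.

Variable nu : {measure set (borel_type R) -> \bar R}.
Hypothesis nuE : forall A, nu A = lebesgue_measure (A `&` I01 : set (measurableTypeR R)).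

Lemma unit_itv_measure (a l : R) : 0 <= a -> 0 <= l -> a + l <= 1 ->
  nu `[a, a + l[%classic = l%:E.
Proof.
move=> a0 l0 al; rewrite nuE (_ : _ `&` _ = `[a, a + l[%classic); last first.
  apply/seteqP; split=> x /=; rewrite !in_itv/=; first by case.
  by move=> /andP[ax xl]; rewrite ax xl /I01/= in_itv/=; split=> //; lra.
rewrite lebesgue_measure_itv/= lte_fin ltrDl; case: ifPn => [_|].
  by rewrite -EFinB addrAC subrr add0r.
by rewrite -leNgt => l0'; congr (_%:E); apply/eqP; rewrite eq_le l0 l0'.
Qed.

(** Inner regularity after removal of a null set. With [Q] empty it gives metric regularity, with
    [Q] containing the discontinuities of a function its Lusin measurability. *)
Lemma unit_interval_regular (B : set (borel_type R)) (Q : set R) (e : R) :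
  measurable B -> countable Q -> 0 < e ->
  exists V : set (borel_type R), [/\ measurable V, V `<=` B `\` Q, compact (V : set R) &
    (nu B <= nu V + e%:E)%E].
Proof.
move=> mB cQ e0; have mBI : measurable (B `&` I01 : set (measurableTypeR R)).
  by apply: measurableI; [exact: borel_type_lebesgue|exact: measurable_itv].
have mQ : measurable (Q : set (measurableTypeR R)) by exact: countable_measurable.
have mD : measurable ((B `&` I01) `\` Q : set (measurableTypeR R)) by exact: measurableD.
have BI_fin : (lebesgue_measure (B `&` I01 : set (measurableTypeR R)) < +oo)%E.
  apply: (@le_lt_trans _ _ (lebesgue_measure (I01 : set (measurableTypeR R)))).
    by apply: le_measure; rewrite ?inE//; exact: measurable_itv.
  by rewrite lebesgue_measure_itv/= lte_fin ltr01 -EFinB ltry.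
have D_fin : (lebesgue_measure ((B `&` I01) `\` Q : set (measurableTypeR R)) < +oo)%E.
  by apply: le_lt_trans BI_fin; apply: le_measure; rewrite ?inE//; exact: subDsetl.
have [V [cV VD DV]] := lebesgue_regularity_inner mD D_fin e0.
have clV : closed V by apply: compact_closed => //; exact: Rhausdorff.
have mV : measurable (V : set (measurableTypeR R)) by exact: closed_measurable.
have VI : V `&` I01 = V by apply: setIidl => x /VD[[]].
exists V; split=> //; [exact: borel_closed|by move=> x /VD[[Bx _] nQ]|].
rewrite !nuE VI.
have BQ : B `&` I01 `<=` (V `|` (((B `&` I01) `\` Q) `\` V)) `|` Q.
  move=> x BIx; have [Qx|nQ] := pselect (Q x); [by right|left].
  by have [Vx|nV] := pselect (V x); [left|right].
apply: (@le_trans _ _ (lebesgue_measure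
    ((V `|` (((B `&` I01) `\` Q) `\` V)) `|` Q : set (measurableTypeR R)))).
  apply: le_measure; rewrite ?inE//.
  by do 2 (apply: measurableU => //); apply: measurableD.
set D := (B `&` I01) `\` Q; have mDV : measurable (D `\` V : set (measurableTypeR R)).
  exact: measurableD.
apply: (@le_trans _ _ (lebesgue_measure (V `|` (D `\` V) : set (measurableTypeR R)) +
    lebesgue_measure (Q : set (measurableTypeR R)))%E).
  by apply: measureU2 => //; exact: measurableU.
rewrite [X in (_ + X <= _)%E](countable_lebesgue_measure0 cQ) adde0.
apply: (@le_trans _ _ (lebesgue_measure (V : set (measurableTypeR R)) +
    lebesgue_measure (D `\` V : set (measurableTypeR R)))%E).
  exact: measureU2.
by apply: leeD => //; exact: ltW.
Qed.

Lemma sup_approx (a : \bar R) (S : set (\bar R)) : (forall x, S x -> x <= a)%E ->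
  (forall e : R, 0 < e -> exists2 x, S x & (a <= x + e%:E)%E) -> a = ereal_sup S.
Proof.
move=> Sa aS; apply/eqP; rewrite eq_le; apply/andP; split; last exact: ge_ereal_sup.
apply/lee_addgt0Pr => e e0; have [x Sx ax] := aS e e0.
by apply: le_trans ax _; rewrite leeD2r//; exact: ereal_sup_ubound.
Qed.

Lemma unit_interval_metrically_regular : metrically_regular nu.
Proof.
move=> B mB; apply: sup_approx => [_ [V [mV VB _ _] <-]|e e0].
  by apply: le_measure; rewrite ?inE.
have [V [mV VB cV BV]] := unit_interval_regular mB (countable0 R) e0.
exists (nu V) => //; exists V => //; split=> //; first by move=> x /VB[].
exists (fun x y => `|x - y|); split=> //.
- by move=> x y _ _; split=> [/eqP|->]; rewrite ?subrr ?normr0// normr_eq0 subr_eq0 => /eqP.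
- by move=> x y _ _; rewrite distrC.
- by move=> x y z _ _ _; exact: ler_distD.
- move=> x Vx A; split.
    by move=> /nbhs_ballP[d /= d0 dA]; exists d => // y Vy xy; exact: dA.
  move=> [d d0 dA]; apply/nbhs_ballP; exists d => //= y xy Vy; exact: dA.
Qed.

Lemma unit_interval_lusin (Y : topologicalType) (g : R -> Y) (Q : set R) :
  countable Q -> (forall t, ~ Q t -> {for t, continuous g}) -> lusin_measurable nu g.
Proof.
move=> cQ gQ B mB; apply: sup_approx => [_ [V [mV VB _ _] <-]|e e0].
  by apply: le_measure; rewrite ?inE.
have [V [mV VB cV BV]] := unit_interval_regular mB cQ e0.
exists (nu V) => //; exists V => //; split=> //; first by move=> x /VB[].
apply/subspace_continuousP => x Vx; apply: cvg_within_filter.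
by apply: gQ => Qx; have [] := VB x Vx.
Qed.

End unit_interval_measure.

(** * Barycenters of measures on the Cantor space *)

Definition pettis_property (R : realType) (E : tvsType R) : Prop :=
  forall (X : ptopologicalType) (nu : {measure set (borel_type X) -> \bar R})
    (D : set E) (g : X -> E),
    metrically_regular nu ->
    tvs_bounded D -> closed D -> absolutely_convex D ->
    lusin_measurable nu g ->
    measurable_fun (setT : set (completion_type nu)) (fun x => gauge_functional D (g x)) ->
    (\int[completion nu]_x gauge_functional D (g x) < +oo)%E ->
    pettis_integrable nu g.

(** Both differences are controlled because neighbourhoods of 0 need not be symmetric. *)
Lemma uniform_limit_continuous (R : realType) (E : tvsType R) (W : topologicalType)
    (P : set W) (r : W -> E) (S : nat -> W -> E) : (forall n, continuous (S n)) ->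
  (forall U, nbhs 0 U -> exists N, forall n w, (N <= n)%N -> P w ->
    U (r w - S n w) /\ U (S n w - r w)) ->
  {within P, continuous r}.
Proof.
move=> cS rS; apply/subspace_continuousP => w wP A rA.
have [U U0 UA] := nbhs0_half (nbhs_origin rA).
have [V V0 VU] := nbhs0_half U0.
have [N NP] := rS V V0.
have UV x : V x -> U x.
  by move=> Vx; rewrite -[x]addr0; apply: VU => //; exact: nbhs_singleton.
have : nbhs w [set v | V (S N v - S N w)] by exact: (cS N w _ (nbhs_translate _ V0)).
suff : nbhs w [set v | V (S N v - S N w)] -> nbhs w [set v | P v -> A (r v)] by [].
apply: filterS => v /= Vv vP.
have [Vr _] := NP N v (leqnn N) vP; have [_ Vrw] := NP N w (leqnn N) wP.
rewrite (_ : r v = r w + ((r v - S N v) + ((S N v - S N w) + (S N w - r w)))).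
  by apply: UA; [exact: UV|exact: VU].
by rewrite !subrKA addrC subrK.
Qed.

Section backward.
Context (R : realType) (E : tvsType R) (h : cantor_space -> E).
Hypotheses (ch : continuous h) (PP : pettis_property E).
Implicit Types (w : seq bool -> R) (s : seq bool).

Let pt s := h (word_point s).

Lemma cell_bounds w s : mass_system w -> 0 <= left_end w s /\ left_end w s + w s <= 1.
Proof.
move=> [w1 w0 wD]; elim: s => [|b s [IH0 IH1]] /=; first by rewrite w1; lra.
have := w0 (false :: s); have := w0 (true :: s); move: IH1; rewrite (wD s).
by case: b; split; lra.
Qed.

Lemma cuts_borel w : measurable (cuts w : set (borel_type R)).
Proof.
rewrite (_ : cuts w = \bigcup_s [set cut w s]); last first.
  by apply/seteqP; split=> [_ [s _ <-]|x [s _ ->]]; exists s.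
apply: countable_bigcupT_measurable => // s.
by apply: borel_closed; exact: closed_eq.
Qed.

(** [r], the Pettis integral of [h \o branch w], is the barycenter of the image under [h] of the
    measure encoded by [w]. The depth [N] is tied to [h] and [V] only, so the Riemann sums converge
    uniformly in [w]. A functional separating the difference from [V] would be at least 1 there,
    while the factor 2 bounds it by one half. *)
Lemma branch_pettis w : mass_system w -> exists r : E, forall (V : set E) N,
  nbhs 0 V -> convex_set V ->
  (forall a b : cantor_space, (forall i, (i < N)%N -> a i = b i) -> V (2 *: (h a - h b))) ->
  forall n, (N <= n)%N -> V (r - cell_sum pt w n [::]).
Proof.
move=> wP; have [nu nuE] := unit_interval_measure R.
pose K := range h; pose D := polar_hull K; pose g : R -> E := h \o branch w.
have cK : compact K.
  by apply: continuous_compact; [exact: continuous_subspaceT|exact: cantor_space_compact].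
have aD : absolutely_convex D.
  by apply: polar_hull_absolutely_convex; exists (h point), point.
have gc t : ~ cuts w t -> {for t, continuous g}.
  by move=> nt; apply: continuous_comp; [exact: branch_continuous|exact: ch].
have nuT : nu setT = 1%E.
  by rewrite nuE setTI lebesgue_measure_itv/= lte_fin ltr01 -EFinB subr0.
have Q0 : nu.-negligible (cuts w : set (borel_type R)).
  exists (cuts w); split=> //; first exact: cuts_borel.
  rewrite nuE; apply: countable_lebesgue_measure0.
  apply: sub_countable (cuts_countable w).
  by apply: subset_card_le; exact: subIsetl.
have mphi : measurable_fun (setT : set (completion_type nu))
    (fun x => gauge_functional D (g x)).
  apply: (measurability _ (ErealGenOInfty.measurableE R)) => _ [_ [c ->] <-].
  set S := _ `&` _.
  have SE : S = [set t : R | (c%:E < gauge_functional D (g t))%E].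
    by apply/seteqP; split=> t; rewrite /S/= in_itv/= andbT; [case|].
  (* The gauge of [g] is lower semicontinuous off the null set [cuts w], so [S] is open up to a
     negligible set. *)
  rewrite (_ : S = interior (S : set R) `|` (S `&` cuts w)); last first.
    apply/seteqP; split=> t; last by case=> [/interior_subset|[]].
    move=> St; have [|nt] := pselect (cuts w t); [by right|left].
    have oD := gauge_open c (@polar_hull_closed _ _ K) aD.
    move: (St); rewrite SE => /= gt.
    have : nbhs (g t) [set e | (c%:E < gauge_functional D e)%E].
      by apply: open_nbhs_nbhs; split.
    by move=> /(gc t nt).
  apply: measurableU.
    by apply: completion_measurable; apply: sub_sigma_algebra; exact: open_interior.
  by apply: completion_negligible; apply: negligibleS Q0; exact: subIsetr.
have phi_fin : (\int[completion nu]_x gauge_functional D (g x) < +oo)%E.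
  apply: (@le_lt_trans _ _ (\int[completion nu]_(x in setT) cst 1%:E x)%E).
    apply: ge0_le_integral => //.
    - by move=> x _; exact: gauge_ge0.
    - move=> x _; apply: ereal_inf_lbound; exists 1 => //; split=> //=.
      exists (g x); last by rewrite scale1r.
      by apply: sub_polar_hull; exists (branch w x).
  rewrite completion_integral_cst; last exact: measurableT.
  by rewrite nuT mule1 ltry.
have := PP (unit_interval_metrically_regular nuE) (polar_hull_bounded cK)
  (@polar_hull_closed _ _ K) aD (unit_interval_lusin nuE (cuts_countable w) gc) mphi phi_fin.
case=> If [r rE]; exists r => V N V0 cV VN n Nn; apply: contrapT.
move=> /(convex_separation V0 cV)[f [cf fV fr]].
have cellE s : nu (cell w s) = (w s)%:E.
  have [l0 l1] := cell_bounds s wP; apply: unit_itv_measure => //.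
  by case: wP.
have cellB s : measurable (cell w s : set (borel_type R)) by exact: borel_itv_co.
have cellM s : measurable (cell w s : set (completion_type nu)).
  exact: completion_measurable.
have Iint s : (completion nu).-integrable (cell w s) (fun x => (f (g x))%:E).
  by apply: integrableS (If f cf).
pose I s := (\int[completion nu]_(x in cell w s) (f (g x))%:E)%E.
(* Induction on the remaining depth [m]. At depth 0 the address of every point of the cell agrees
   with [s] on the first [N] bits, so [f] deviates upwards from its value at the sample point by at
   most one half; cells and sums split alike. *)
have Ile m s : (N <= size s + m)%N ->
    (I s <= ((f (cell_sum pt w m s) : R) + 2^-1 * w s)%:E)%E.
  elim: m s => [|m IH] s Nsm /=.
    have fle t : cell w s t -> (f (g t) : R) <= f (pt s) + 2^-1.
      move=> st; have sE := branch_word_cell wP st.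
      have /fV : V (2 *: (g t - pt s)).
        apply: VN => i iN; have ils : (i < size s)%N.
          by rewrite -[size s]addn0; exact: leq_trans Nsm.
        by rewrite (branch_word_point w t ils) sE.
      rewrite functionalZ functionalB; lra.
    apply: (@le_trans _ _
      (\int[completion nu]_(x in cell w s) cst ((f (pt s) : R) + 2^-1)%:E x)%E).
      apply: le_integral => //; last by move=> x /set_mem sx; rewrite lee_fin; exact: fle.
      apply/integrableP; split=> //.
      rewrite (_ : (fun x => _) = cst `|((f (pt s) : R) + 2^-1)%:E|%E)//.
      by rewrite (completion_integral_cst nu _ (cellB s)) cellE -EFinM ltry.
    by rewrite completion_integral_cst// cellE -EFinM lee_fin functionalZ mulrDl mulrC.
  rewrite /I cell_split// integral_setU//; last 2 first.
  - by rewrite -cell_split//; have /integrableP[] := Iint s.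
  - exact: cell_disjoint.
  apply: le_trans (leeD (IH (false :: s) _) (IH (true :: s) _)) _.
  - by rewrite /= addSnnS.
  - by rewrite /= addSnnS.
  rewrite -EFinD lee_fin functionalD; have [_ _ /(_ s) ->] := wP; lra.
have IT : (f r)%:E = I [::].
  have mC : measurable (~` cell w [::] : set (borel_type R)) by exact: measurableC.
  have C0 : completion nu (~` cell w [::]) = 0%E.
    rewrite completion_eq// nuE (_ : _ `&` _ = set0) ?measure0//.
    by apply/seteqP; split=> x //= [nx x01]; apply: nx; rewrite /cell/= add0r; case: wP => ->.
  rewrite rE//.
  have mC' : measurable (~` cell w [::] : set (completion_type nu)) by exact: measurableC.
  have -> : (\int[completion nu]_x (f (g x))%:E =
      \int[completion nu]_(x in setT `\` ~` cell w [::]) (f (g x))%:E)%E.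
    by apply: negligible_integral => //; exact: If.
  by rewrite setDE setCK setTI.
have := Ile n [::] Nn; rewrite -IT lee_fin; have [-> _ _] := wP.
move: fr; rewrite functionalB; lra.
Qed.

(** The prefixes of [a]. As numbers, these truth values are the cylinder masses of the unit mass at
    [a]. *)
Fixpoint word_of (a : cantor_space) s :=
  if s is b :: s' then (b == a (size s')) && word_of a s' else true.

Lemma word_of_point a s : word_of a s -> forall i, (i < size s)%N -> word_point s i = a i.
Proof.
elim: s => // b s IH /= /andP[/eqP -> sa] i.
rewrite /word_point rev_cons nth_rcons size_rev ltnS leq_eqVlt => /predU1P[->|ni].
  by rewrite ltnn eqxx.
by rewrite ni; exact: IH.
Qed.

Lemma word_of_mass a : mass_system (fun s => (word_of a s)%:R : R).
Proof.
split=> [//|s|s]; first exact: ler0n.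
by rewrite /=; case: (a (size s)); rewrite /= ?addr0 ?add0r.
Qed.

(** For a unit mass the Riemann sum reduces to its only term of nonzero weight, the sample point of
    the prefix of [a] of that length. *)
Lemma word_of_cell_sum a n s :
  if word_of a s then exists z, [/\ word_of a z, size z = (size s + n)%N &
    cell_sum pt (fun s => (word_of a s)%:R : R) n s = pt z]
  else cell_sum pt (fun s => (word_of a s)%:R : R) n s = 0.
Proof.
elim: n s => [|n IH] s /=.
  case: ifP => sa; rewrite sa ?scale0r// scale1r.
  by exists s; rewrite addn0.
have := IH (false :: s); have := IH (true :: s) => /=.
case: (word_of a s); rewrite ?andbT ?andbF; last by move=> -> ->; rewrite addr0.
by case: (a (size s)) => /= [[z [za sz ->]] ->|-> [z [za sz ->]]];
  exists z; rewrite sz addSnnS ?addr0 ?add0r.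
Qed.

Hypothesis hE : hausdorff_space E.

Lemma cantor_hull_compact : compact (closed_convex_hull (range h)).
Proof.
have /choice[r rP] : forall w : mass_space R, exists r : E, mass_system w ->
    forall (V : set E) N, nbhs 0 V -> convex_set V ->
    (forall a b : cantor_space, (forall i, (i < N)%N -> a i = b i) -> V (2 *: (h a - h b))) ->
    forall n, (N <= n)%N -> V (r - cell_sum pt w n [::]).
  move=> w; have [wP|nw] := pselect (mass_system w); last by exists 0.
  by have [r rP] := branch_pettis wP; exists r.
have r_unif U : nbhs 0 U -> exists N, forall n (w : mass_space R), (N <= n)%N ->
    mass_system w -> U (r w - cell_sum pt w n [::]) /\ U (cell_sum pt w n [::] - r w).
  move=> U0.
  have NU0 : nbhs 0 [set v | U (- v)].
    by have := nbhs0N U0; apply: filterS => _ [v Uv <-]; rewrite /= opprK.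
  have [V [V0 cV VU]] := nbhs0_convex (filterI U0 NU0).
  have [N NP] := cantor_uniform ch (nbhs0_scale (r := 2) (A := V) ltac:(by []) V0).
  exists N => n w Nn wP; have /VU[? ] := rP w wP V N V0 cV NP n Nn.
  by rewrite /= opprB.
have r_cont : {within (@mass_system R : set (mass_space R)), continuous r}.
  apply: (@uniform_limit_continuous _ _ _ _ _
    (fun n (w : mass_space R) => cell_sum pt w n [::])) => // n.
  exact: (@cell_sum_continuous _ _ pt _ (fun w : mass_space R => w : seq bool -> R)
    n [::] (@mass_space_eval R)).
pose S := r @` (@mass_system R : set (mass_space R)).
have cS : compact S by apply: continuous_compact => //; exact: mass_system_compact.
have clS : closed S by exact: compact_closed.
have vS : convex_set S.
  apply/convex_setP => _ _ t t0 t1 [w wP <-] [v vP <-].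
  pose u : mass_space R := fun s => t * (w : seq bool -> R) s + (1 - t) * (v : seq bool -> R) s.
  have uP : mass_system u.
    case: wP vP => [w1 w0 wD] [v1 v0 vD]; split=> [|s|s]; rewrite /u.
    - by rewrite w1 v1; lra.
    - by rewrite addr_ge0// mulr_ge0// subr_ge0.
    - by rewrite wD vD; ring.
  (* The barycenter map is affine because the Riemann sums are affine in the masses and approximate
     it uniformly. *)
  exists u => //; apply/eqP; rewrite -subr_eq0; apply/eqP; apply: hausdorff_nbhs0 => // U U0.
  have [V0 V00 VU] := nbhs0_half U0; have [V [nV cV VV0]] := nbhs0_convex V00.
  have [N NP] := r_unif V nV.
  have [Vu _] := NP N u (leqnn N) uP.
  have [_ Vw] := NP N w (leqnn N) wP; have [_ Vv] := NP N v (leqnn N) vP.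
  rewrite (_ : r u - _ = (r u - cell_sum pt u N [::]) +
    (t *: (cell_sum pt w N [::] - r w) + (1 - t) *: (cell_sum pt v N [::] - r v))).
    by apply: VU; apply: VV0 => //; move/convex_setP : cV; apply.
  have uE := cell_sum_conv pt w v t (1 - t) N [::].
  rewrite (_ : t *: (_ - r w) + _ = cell_sum pt u N [::] - (t *: r w + (1 - t) *: r v)).
    by rewrite subrKA.
  by rewrite [cell_sum pt u N [::]]uE !scalerBr addrACA -opprD.
have KS : range h `<=` S.
  move=> _ [a _ <-]; exists (fun s => (word_of a s)%:R : R); first exact: word_of_mass.
  set w := (fun s => _); apply/eqP; rewrite -subr_eq0; apply/eqP.
  apply: hausdorff_nbhs0 => // U U0; have [V V0 VU] := nbhs0_half U0.
  have [N NP] := r_unif V V0; have [M MP] := cantor_uniform ch V0.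
  (* At depth [N + M] the Riemann sum is close to the barycenter thanks to [N], and its single
     sample point is close to [h a] thanks to [M]. *)
  have [Vr _] := NP (N + M)%N w (leq_addr _ _) (word_of_mass a).
  have /= [z [za sz zE]] := word_of_cell_sum a (N + M) [::].
  rewrite (_ : r w - h a = (r w - cell_sum pt w (N + M) [::]) + (pt z - h a)).
    apply: VU => //; apply: MP => i iM; apply: word_of_point => //.
    by rewrite sz add0n ltn_addl.
  by rewrite /w zE addrA subrK.
apply: (subclosed_compact _ cS); last by move=> x; apply; split.
by apply: closed_bigI => A [[]].
Qed.

End backward.

Lemma pettis_property_mcc (R : realType) (E : tvsType R) :
  hausdorff_space E -> pettis_property E -> metric_convex_compactness E.
Proof.
move=> hE PP K cK mK; have [K0|K0] := pselect (K !=set0).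
  by have [h [ch <-]] := cantor_onto K0 cK mK; exact: cantor_hull_compact.
(* The Cantor space has no map onto the empty set, which is its own closed convex hull. *)
rewrite (_ : closed_convex_hull K = set0); first exact: compact0.
apply/seteqP; split=> // x; apply; split; last by move=> y Ky; apply: K0; exists y.
by split; [exact: closed0|move=> y z l; rewrite inE].
Qed.

Theorem theorem2 (R : realType) (E : tvsType R) (hE : hausdorff_space E) :
  metric_convex_compactness E <->
  (forall (X : ptopologicalType) (nu : {measure set (borel_type X) -> \bar R})
     (D : set E) (g : X -> E),
     metrically_regular nu ->
     tvs_bounded D -> closed D -> absolutely_convex D ->
     lusin_measurable nu g ->
     measurable_fun (setT : set (completion_type nu)) (fun x => gauge_functional D (g x)) ->
     (\int[completion nu]_x gauge_functional D (g x) < +oo)%E ->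
     pettis_integrable nu g).
Proof.
split=> [mccE X nu D g rnu bD _ aD lg mphi phi_fin|PP].
  exact: mcc_pettis bD aD mphi phi_fin.
exact: pettis_property_mcc.
Qed.
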